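(* For every positive integer $k$, $$\zeta_{\rm odd\ girth}(2k+1)\ge 2\cdot\left(\frac{k}{2k+1}\right)^{\frac{k}{2k+1}}\cdot\left(\frac{k+1}{2k+1}\right)^{\frac{k+1}{2k+1}}.$$
   Context: A distance graph in $\mathbb{R}^n$ is a graph $G=(V,E)$ with $V\subseteq\mathbb{R}^n$ and, for some real $a>0$, $E\subseteq\{\{x,y\}: x,y\in V,\ |x-y|=a\}$ (Euclidean norm). $\chi(G)$ is the chromatic number, and $g_{\rm odd}(G)$ is the length of a shortest odd cycle in $G$ (infinite if there is none). For an integer $k$, $\zeta_{\rm odd\ girth}(k)$ is the supremum of all real $\zeta$ for which there exists a function $\delta(n)\to0$ ($n\to\infty$) such that for every $n$ there is a distance graph $G$ in $\mathbb{R}^n$ with $g_{\rm odd}(G)>k$ and $\chi(G)\ge(\zeta+\delta(n))^n$. *)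

(* Defs.v *)
From mathcomp Require Import all_boot all_order all_algebra.
From mathcomp Require Import all_classical all_reals all_analysis.
Import Order.TTheory GRing.Theory Num.Theory numFieldNormedType.Exports.

Set Implicit Arguments.
Unset Strict Implicit.
Unset Printing Implicit Defensive.

Local Open Scope classical_set_scope.
Local Open Scope ring_scope.

(* Simple graphs with a possibly infinite vertex set; an edge is an unordered
   pair of distinct vertices. *)
Record sgraph (T : Type) := SGraph {
  vertices : set T;
  edges : set (set T);
  edgesP : forall e, edges e ->
    exists x y, [/\ vertices x, vertices y, x <> y & e = [set x; y]] }.

Definition adjacent (T : Type) (G : sgraph T) (x y : T) : Prop :=
  edges G [set x; y].

(* Colours are the naturals below m; the bound is imposed on the vertices only,
   so that the graph without vertices is 0-colourable. *)
Definition colorable (T : Type) (G : sgraph T) (m : nat) : Prop :=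
  exists f : T -> nat,
    (forall x, vertices G x -> (f x < m)%N) /\
    (forall x y, adjacent G x y -> f x <> f y).

(* Equal to +oo when no finite number of colours suffices. *)
Definition chromatic_number (R : realType) (T : Type) (G : sgraph T) : \bar R :=
  ereal_inf [set (m%:R)%:E | m in [set m : nat | colorable G m]].

Definition is_odd_cycle (T : eqType) (G : sgraph T) (c : seq T) : Prop :=
  [/\ ucycle (fun x y => `[< adjacent G x y >]) c, (2 < size c)%N
    & odd (size c)].

(* Equal to +oo when G has no odd cycle. *)
Definition odd_girth (R : realType) (T : eqType) (G : sgraph T) : \bar R :=
  ereal_inf [set ((size c)%:R)%:E | c in [set c : seq T | is_odd_cycle G c]].

(* The canonical norm `|x| on row vectors is the sup norm, hence this one. *)
Definition euclidean_norm (R : realType) (n : nat) (x : 'rV[R]_n) : R :=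
  Num.sqrt (\sum_(i < n) x ord0 i ^+ 2).

Definition is_distance_graph (R : realType) (n : nat) (G : sgraph 'rV[R]_n) :
    Prop :=
  exists2 a : R, 0 < a &
    edges G `<=` [set e | exists x y,
      [/\ vertices G x, vertices G y, euclidean_norm (x - y) = a
        & e = [set x; y]]].

Definition admissible_zeta (R : realType) (k : int) : set R :=
  [set zeta | exists2 delta : nat -> R, delta @ \oo --> (0 : R) &
    forall n : nat, (0 < n)%N ->
      exists G : sgraph 'rV[R]_n,
        [/\ is_distance_graph G,
            ((k%:~R)%:E < odd_girth R G)%E
          & (((zeta + delta n) ^+ n)%:E <= chromatic_number R G)%E]].

Definition zeta_odd_girth (R : realType) (k : int) : \bar R :=
  ereal_sup [set zeta%:E | zeta in @admissible_zeta R k].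

(* Main.v *)
Require Import Defs.
From mathcomp Require Import all_boot all_order all_algebra.
From mathcomp Require Import all_classical all_reals all_analysis.
From mathcomp Require Import zify ring lra.
Import Order.TTheory GRing.Theory Num.Theory numFieldNormedType.Exports.

(** Take as vertices the 0/1 vectors of even weight in R^n and as edges the pairs
    at Hamming distance 2p, where p is a prime slightly larger than kn/(2k+1).
    Along an odd cycle of length L every coordinate changes an even number of
    times, hence at most L - 1 times, so 2pL <= (L - 1)n, which rules out
    L <= 2k+1.  A set of vertices without an edge satisfies the Frankl-Wilson
    bound: modulo p the polynomial prod_{0<r<p} (dist(A, B) - r) vanishes unless
    dist(A, B) is 0 or 2p, so such a set has at most sum_{i<p} C(n, i) elements.
    The ratio of 2^(n-1) to this sum is the required exponential.

    One needs a prime in (x, (1+eps)x] for all large x.  This is derived, without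
    the prime number theorem, from Selberg's formula
      psi(x) ln x + sum_{n<=x} Lambda(n) psi(x/n) = 2x ln x + O(x)
    by Erdos' argument.  The formula bounds the density of primes on any interval
    by 2 + o(1); if (x, lx] contains few primes, then (x/n, lx/n] has the extremal
    density 2 for almost all prime powers n.  When l is nearly the threshold above
    which every interval (y, l'y] has a positive proportion of primes, these n are
    so frequent that the extremal intervals cover most of a long range, on which
    the density of primes would be close to 2, against Mertens' theorem. *)

Set Implicit Arguments.
Unset Strict Implicit.
Unset Printing Implicit Defensive.
Local Open Scope ring_scope.

(** * Moebius and von Mangoldt functions *)

Section DivisorSums.
Local Open Scope nat_scope.
Variable V : nmodType.
Implicit Types (h : nat -> V) (d m n N : nat).

Lemma sum_multiples h d N : 0 < d ->
  (\sum_(1 <= n < N.+1 | (d %| n)%N) h n = \sum_(1 <= m < (N %/ d)%N.+1) h (d * m)%N)%R.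
Proof.
move=> d0; elim: N => [|N IH]; first by rewrite div0n !big_geq.
rewrite big_mkcond big_nat_recr //= -big_mkcond /= IH divnS //.
case: ifP => [dN|_]; last by rewrite addr0 add0n.
rewrite add1n [RHS]big_nat_recr //=; congr (_ + h _)%R.
have -> : (N %/ d).+1 = N.+1 %/ d by rewrite divnS // dN.
by rewrite mulnC divnK.
Qed.

Lemma sum_divisors_widen h n N : 0 < n <= N ->
  (\sum_(1 <= d < N.+1 | (d %| n)%N) h d = \sum_(1 <= d < n.+1 | (d %| n)%N) h d)%R.
Proof.
move=> /andP[n0 nN]; rewrite (@big_cat_nat _ _ _ n.+1) //= [X in (_ + X)%R]big1_seq ?addr0 //.
move=> d /andP[dn]; rewrite mem_index_iota => /andP[nd _].
by have := dvdn_leq n0 dn; rewrite leqNgt nd.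
Qed.

Lemma sum_divisors_swap (g : nat -> nat -> V) N :
  (\sum_(1 <= d < N.+1) \sum_(1 <= m < (N %/ d)%N.+1) g d (d * m)%N
   = \sum_(1 <= n < N.+1) \sum_(1 <= d < n.+1 | (d %| n)%N) g d n)%R.
Proof.
transitivity (\sum_(1 <= n < N.+1) \sum_(1 <= d < N.+1 | (d %| n)%N) g d n)%R.
  rewrite [RHS](exchange_big_dep_nat xpredT) //=; apply: eq_big_nat => d /andP[d0 _].
  by rewrite -(sum_multiples (g d)).
by apply: eq_big_nat => n /andP[n0]; rewrite ltnS => nN; rewrite sum_divisors_widen // n0.
Qed.

End DivisorSums.

Section Moebius.
Local Open Scope nat_scope.

Definition moebius (n : nat) : int :=
  if all (fun p => logn p n == 1) (primes n) then ((-1) ^+ size (primes n))%R else 0%R.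

Lemma normr_moebius n : (`|moebius n| <= 1)%R.
Proof. by rewrite /moebius; case: ifP; rewrite ?normr0 // normrX normrN1 expr1n. Qed.

Lemma moebius1 : moebius 1 = 1%R. Proof. by []. Qed.

Lemma moebius_mulp p d : prime p -> 0 < d -> ~~ (p %| d) ->
  moebius (p * d) = (- moebius d)%R.
Proof.
move=> pp d0 pd; have p0 := prime_gt0 pp.
have pNd : p \notin primes d by rewrite mem_primes pp d0.
have prm : perm_eq (primes (p * d)) (p :: primes d).
  apply: uniq_perm; rewrite ?primes_uniq //= ?pNd ?primes_uniq // => q.
  by rewrite primesM // primes_prime // !inE.
rewrite /moebius (perm_size prm) (perm_all _ prm) /= lognM // logn_prime // eqxx.
rewrite lognE pp d0 (negbTE pd) /= exprS mulN1r.
have -> : all (fun q => logn q (p * d) == 1) (primes d) =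
          all (fun q => logn q d == 1) (primes d).
  apply: eq_in_all => q qd; rewrite lognM // logn_prime //.
  by have /negbTE -> : q != p by apply: contraNneq pNd => <-.
by case: ifP; rewrite ?oppr0.
Qed.

Lemma moebius_sqr p d : prime p -> 0 < d -> p %| d -> moebius (p * d) = 0%R.
Proof.
move=> pp d0 pd; have p0 := prime_gt0 pp.
rewrite /moebius; case: ifP => // /allP /(_ p).
rewrite mem_primes pp muln_gt0 p0 d0 dvdn_mulr // => /(_ isT).
rewrite lognM // logn_prime // eqxx.
have := logn_gt0 p d; rewrite mem_primes pp d0 pd /=; lia.
Qed.

(** With p the least prime factor of n = p m > 1, the divisors p d with p | d contribute 0, and
    every other p d cancels against the divisor d of m. *)
Lemma sum_moebius n : 0 < n ->
  (\sum_(1 <= d < n.+1 | (d %| n)%N) moebius d)%R = ((n == 1%N)%:R)%R.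
Proof.
move=> n0; have [->|n1] := eqVneq n 1; first by rewrite big_mkcond big_nat1 moebius1.
have {}n1 : 1 < n by lia.
have pp := pdiv_prime n1; set p := pdiv n in pp; have p0 := prime_gt0 pp.
have [m nE] : exists m, n = p * m.
  by exists (n %/ p); rewrite mulnC divnK // pdiv_dvd.
have m0 : 0 < m by move: n0; rewrite nE muln_gt0 => /andP[].
rewrite (bigID (fun d => p %| d)) /=.
under eq_bigl do rewrite andbC; rewrite big_mkcondr sum_multiples //=.
rewrite nE mulKn // -big_mkcond /=.
under eq_bigl do rewrite dvdn_pmul2l //.
rewrite (bigID (fun d => p %| d)) /= big1_seq ?add0r; last first.
  move=> d /andP[/andP[dm pd]]; rewrite mem_index_iota => /andP[d0 _].
  exact: moebius_sqr.
rewrite [X in (_ + X)%R](_ : _ = (\sum_(1 <= d < m.+1 | (d %| m)%N && ~~ (p %| d)%N) moebius d)%R).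
  rewrite -big_split /= big_seq_cond big1 // => d /andP[].
  by rewrite mem_index_iota => /andP[d0 _] /andP[dm pd]; rewrite moebius_mulp // addNr.
transitivity (\sum_(1 <= d < (p * m).+1 | (d %| m)%N) if ~~ (p %| d)%N then moebius d else 0)%R.
  rewrite -[RHS]big_mkcondr /=; apply: eq_bigl => d.
  case pd: (p %| d); rewrite ?andbF // !andbT Gauss_dvdr //.
  by rewrite coprime_sym prime_coprime // pd.
by rewrite sum_divisors_widen ?m0 ?leq_pmull // -big_mkcondr.
Qed.

End Moebius.

Section Mangoldt.
Variable R : realType.

(** A number above 1 is a prime power exactly when it is the full power of its least prime factor.
    At 1 the test succeeds with [pdiv 1 = 1], and ln 1 = 0. *)
Definition mangoldt (n : nat) : R :=
  if n == (pdiv n ^ logn (pdiv n) n)%N then ln (pdiv n)%:R else 0.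

Lemma ln_nat_ge0 n : 0 <= ln n%:R :> R.
Proof. by case: n => [|n]; [rewrite ln0 | rewrite ln_ge0 // ler1n]. Qed.

Lemma mangoldt_ge0 n : 0 <= mangoldt n.
Proof. by rewrite /mangoldt; case: ifP => // _; exact: ln_nat_ge0. Qed.

Lemma mangoldt_pexp p a : prime p -> (0 < a)%N -> mangoldt (p ^ a) = ln p%:R.
Proof. by case: a => // a pp _; rewrite /mangoldt pdiv_pfactor // pfactorK // eqxx. Qed.

Lemma mangoldt_neq0 n : (0 < n)%N -> mangoldt n != 0 ->
  exists p a, [/\ prime p, (0 < a)%N & n = (p ^ a)%N].
Proof.
move=> n0; rewrite /mangoldt; case: ifP => [/eqP nE|_ /eqP //].
have [n1|n1 _] := leqP n 1.
  have -> : n = 1%N by lia.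
  by rewrite ln1 eqxx.
exists (pdiv n), (logn (pdiv n) n); split=> //; first exact: pdiv_prime.
by rewrite logn_gt0 mem_primes pdiv_prime // n0 pdiv_dvd.
Qed.

Lemma mangoldt_le n : mangoldt n <= ln n%:R.
Proof.
rewrite /mangoldt; case: ifP => _; last exact: ln_nat_ge0.
have [->|n0] := posnP n; first by rewrite ln1 ln0.
by rewrite ler_ln ?posrE ?ltr0n ?pdiv_gt0 // ler_nat pdiv_leq.
Qed.

(** Induction from m to n = p m: among the divisors of n that do not divide m, only the full power
    of p is a prime power, so the sum grows by ln p. *)
Lemma sum_mangoldt n : (0 < n)%N ->
  \sum_(1 <= d < n.+1 | (d %| n)%N) mangoldt d = ln n%:R.
Proof.
elim/ltn_ind: n => n IH n0.
have [n1|n1] := leqP n 1.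
  have -> : n = 1%N by lia.
  rewrite big_mkcond big_nat1 dvd1n /mangoldt (_ : pdiv 1 = 1%N) // ln1.
have pp := pdiv_prime n1; set p := pdiv n in pp; have p0 := prime_gt0 pp.
have [m nE] : exists m, n = (p * m)%N.
  by exists (n %/ p)%N; rewrite mulnC divnK // pdiv_dvd.
have m0 : (0 < m)%N by move: n0; rewrite nE muln_gt0 => /andP[].
have mn : (m < n)%N by rewrite nE ltn_Pmull // prime_gt1.
set a := logn p n.
have aE : a = (logn p m).+1 by rewrite /a nE lognM // logn_prime // eqxx.
have pan : (p ^ a %| n)%N by rewrite pfactor_dvdn.
have panm : ~~ (p ^ a %| m)%N by rewrite pfactor_dvdn // aE ltnn.
rewrite (bigID (fun d => (d %| m)%N)) /=.
have -> : \sum_(1 <= d < n.+1 | (d %| n)%N && (d %| m)%N) mangoldt d = ln m%:R.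
  rewrite -(IH m) // -(@sum_divisors_widen _ _ m n) ?m0 1?ltnW //.
  apply: eq_bigl => d; case dm: (d %| m)%N; rewrite ?andbF // andbT nE.
  by rewrite dvdn_mull.
rewrite -big_filter (bigD1_seq (p ^ a)%N) ?filter_uniq ?iota_uniq //=; last first.
  by rewrite mem_filter pan panm mem_index_iota expn_gt0 p0 /= ltnS dvdn_leq.
rewrite big_filter_cond big1_seq ?addr0; last first.
  move=> d /andP[/andP[/andP[dn dm] dpa]]; rewrite mem_index_iota => /andP[d0 _].
  apply/eqP; apply: contraNT dpa => /(mangoldt_neq0 d0)[q [b [pq b0 dE]]].
  have [qp|qp] := eqVneq q p; last first.
    case/negP: dm; move: dn; rewrite nE dE Gauss_dvdr //.
    by rewrite coprimeXl // prime_coprime // dvdn_prime2 //; apply/eqP/eqP.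
  move: dn dm; rewrite dE qp !pfactor_dvdn // -/a aE => ba bm.
  by apply/eqP; congr (_ ^ _)%N; lia.
rewrite mangoldt_pexp ?aE // [in RHS]nE natrM lnM ?posrE ?ltr0n //.
by rewrite addrC.
Qed.

(** Moebius inversion: ln(n/d) is expanded by [sum_mangoldt] over e | n/d, and after the swap the
    sum of the Moebius function over d | n/e leaves only e = n. *)
Lemma sum_moebius_ln n : (0 < n)%N ->
  \sum_(1 <= d < n.+1 | (d %| n)%N) (moebius d)%:~R * ln (n%:R / d%:R) = mangoldt n.
Proof.
move=> n0.
transitivity (\sum_(1 <= d < n.+1 | (d %| n)%N)
   \sum_(1 <= e < n.+1 | (e %| n %/ d)%N) (moebius d)%:~R * mangoldt e).
  rewrite big_seq_cond [RHS]big_seq_cond; apply: eq_bigr => d /andP[].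
  rewrite mem_index_iota => /andP[d0 dn'] dn.
  rewrite -mulr_sumr sum_divisors_widen ?sum_mangoldt ?divn_gt0 ?leq_div ?(dvdn_leq n0 dn) //.
  congr (_ * ln _); apply: (canLR (mulfK _)); first by rewrite pnatr_eq0; lia.
  by rewrite -natrM divnK.
transitivity (\sum_(1 <= e < n.+1 | (e %| n)%N)
   \sum_(1 <= d < n.+1 | (d %| n %/ e)%N) (moebius d)%:~R * mangoldt e).
  (* The condition e d | n is symmetric, which justifies the swap. *)
  have sw d e : (0 < d)%N -> (d %| n)%N && (e %| n %/ d)%N = (e * d %| n)%N.
    move=> d0; apply/andP/idP => [[dn en]|edn].
      by rewrite -(divnK dn) dvdn_pmul2r.
    have dn : (d %| n)%N := dvdn_trans (dvdn_mull _ (dvdnn d)) edn.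
    by rewrite dn; split=> //; rewrite -(dvdn_pmul2r d0) divnK.
  rewrite [LHS]big_mkcond [RHS]big_mkcond /=.
  under eq_bigr do rewrite big_mkcond /= -[X in if _ then X else _]big_mkcond.
  under [RHS]eq_bigr do rewrite big_mkcond /= -[X in if _ then X else _]big_mkcond.
  transitivity (\sum_(1 <= d < n.+1) \sum_(1 <= e < n.+1 | (e * d %| n)%N) (moebius d)%:~R * mangoldt e).
    apply: eq_big_nat => d /andP[d0 _]; under [RHS]eq_bigl do rewrite -sw //.
    by case: ifP => //= _; rewrite ?big_pred0.
  rewrite (exchange_big_dep_nat xpredT) //=.
  apply: eq_big_nat => e /andP[e0 _]; under [LHS]eq_bigl do rewrite mulnC -sw //.
  by case: ifP => //= _; rewrite ?big_pred0.
rewrite big_mkcond (big_nat_recr n) //= dvdnn divnn n0 /=.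
rewrite big1_seq ?add0r.
  rewrite -mulr_suml -[X in X * _]rmorph_sum /= sum_divisors_widen ?n0 //.
  by rewrite sum_moebius //= mul1r.
move=> e /=; rewrite mem_index_iota => /andP[e0 en]; case: ifP => // edn.
have ne0 : (0 < n %/ e)%N by rewrite divn_gt0 // ltnW.
rewrite -mulr_suml -[X in X * _]rmorph_sum /= sum_divisors_widen ?ne0 ?leq_div //.
rewrite sum_moebius // -(eqn_pmul2r e0) divnK // mul1n gtn_eqF // mul0r //.
Qed.

Lemma ln_fact N : ln (N`!)%:R = \sum_(1 <= n < N.+1) ln n%:R :> R.
Proof.
elim: N => [|N IH]; first by rewrite big_geq // fact0 ln1.
by rewrite factS natrM lnM ?posrE ?ltr0n ?fact_gt0 // big_nat_recr //= IH addrC.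
Qed.

Lemma ln_fact_mangoldt N :
  ln (N`!)%:R = \sum_(1 <= n < N.+1) mangoldt n * (N %/ n)%:R.
Proof.
rewrite ln_fact; transitivity (\sum_(1 <= n < N.+1) \sum_(1 <= d < n.+1 | (d %| n)%N) mangoldt d).
  by apply: eq_big_nat => n /andP[n0 _]; rewrite sum_mangoldt.
rewrite -(sum_divisors_swap (fun d _ => mangoldt d)); apply: eq_bigr => d _.
by rewrite sumr_const_nat subn1 /= mulr_natr.
Qed.

(* Applied to f(n) = psi(N/n) - N/n + gamma + 1, whose inner sums are O(ln(N/d)),
   this yields Selberg's formula. *)
Lemma tatuzawa_iseki N (f : nat -> R) : (0 < N)%N ->
  \sum_(1 <= d < N.+1) (moebius d)%:~R * ln (N%:R / d%:R) *
      (\sum_(1 <= m < (N %/ d).+1) f (d * m)%N)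
  = f 1%N * ln N%:R + \sum_(1 <= n < N.+1) f n * mangoldt n.
Proof.
move=> N0; under eq_bigr do rewrite mulr_sumr.
rewrite (sum_divisors_swap (fun d n => (moebius d)%:~R * ln (N%:R / d%:R) * f n)).
(* Since ln(N/d) = ln(N/n) + ln(n/d), the sum over d | n splits into the cases of [sum_moebius] and
   [sum_moebius_ln]. *)
transitivity (\sum_(1 <= n < N.+1) f n * ((n == 1%N)%:R * ln (N%:R / n%:R) + mangoldt n)).
  apply: eq_big_nat => n /andP[n0 nN].
  rewrite -mulr_suml mulrC; congr (_ * _).
  rewrite -sum_moebius_ln // -[(n == 1%N)%:R](rmorph_nat (intr : int -> R)) -sum_moebius // rmorph_sum.
  rewrite mulr_suml -big_split /= big_seq_cond [RHS]big_seq_cond; apply: eq_bigr => d /andP[].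
  rewrite mem_index_iota => /andP[d0 _] dn; rewrite -mulrDr -lnM ?posrE ?divr_gt0 ?ltr0n //.
  by congr (_ * ln _); field; rewrite !pnatr_eq0; lia.
under eq_bigr do rewrite mulrDr; rewrite big_split /=; congr (_ + _).
rewrite big_nat_recl //= mul1r divr1 big1_seq ?addr0 //.
by move=> i; rewrite mem_index_iota => /andP[_ /andP[i0 _]]; rewrite eqSS (gtn_eqF i0) mul0r mulr0.
Qed.

End Mangoldt.

(** * Chebyshev, Mertens and Selberg estimates *)

Section Estimates.
Variable R : realType.
Implicit Types N n d k : nat.
Local Notation Lambda := (@mangoldt R).

Lemma ln_le_subr1 (x : R) : 0 < x -> ln x <= x - 1.
Proof. by move=> x0; have := @le_ln1Dx R (x - 1); rewrite addrCA subrr addr0; apply; lra. Qed.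

Lemma ln_ge_subrV (x : R) : 0 < x -> 1 - x^-1 <= ln x.
Proof.
move=> x0; have := @ln_le_subr1 x^-1; rewrite invr_gt0 lnV ?posrE // => /(_ x0); lra.
Qed.

Lemma ln_succ_le n : (0 < n)%N -> ln n.+1%:R - ln n%:R <= n%:R^-1 :> R.
Proof.
move=> n0; have nR : 0 < n%:R :> R by rewrite ltr0n.
rewrite -ln_div ?posrE ?ltr0n //; apply: le_trans (ln_le_subr1 _) _.
  by rewrite divr_gt0 ?ltr0n.
by rewrite -natr1 mulrDl divff ?gt_eqF // mul1r; lra.
Qed.

Lemma ln_succ_ge n : (0 < n)%N -> n.+1%:R^-1 <= ln n.+1%:R - ln n%:R :> R.
Proof.
move=> n0; have nR : 0 < n%:R :> R by rewrite ltr0n.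
rewrite -ln_div ?posrE ?ltr0n //; apply: le_trans (ln_ge_subrV _); last first.
  by rewrite divr_gt0 ?ltr0n.
rewrite invf_div -[X in X - _](@divff _ n.+1%:R) ?pnatr_eq0 // -mulrBl -natr1.
by rewrite (_ : n%:R + 1 - n%:R = 1) ?mul1r //; lra.
Qed.

Lemma ln_fact_bounds N : (0 < N)%N ->
  N%:R * ln N%:R - N%:R <= ln ((N`!)%:R : R) <= N%:R * ln N%:R - N%:R + 1 + ln N%:R.
Proof.
elim: N => // -[_ _|N IH _]; first by rewrite (_ : 1`! = 1%N) // ln1; lra.
have /andP[IH1 IH2] := IH isT.
rewrite factS natrM lnM ?posrE ?ltr0n ?fact_gt0 //.
have nR : 1 <= N.+1%:R :> R by rewrite ler1n.
have := @ln_succ_le N.+1 isT; have := @ln_succ_ge N.+1 isT.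
set l := ln N.+1%:R in IH1 IH2 *; set l' := ln N.+2%:R.
rewrite -(natr1 N.+1); set x : R := N.+1%:R in nR IH1 IH2 *.
move=> h1 h2.
have h3 : x * (l' - l) <= 1.
  by have := ler_wpM2l (ltW (lt_le_trans ltr01 nR)) h2; rewrite mulfV // gt_eqF; lra.
have h4 : 1 <= (x + 1) * (l' - l).
  have x1 : 0 < x + 1 by lra.
  by have := ler_wpM2l (ltW x1) h1; rewrite mulfV ?gt_eqF.
apply/andP; split; nra.
Qed.

Definition harmonic_sum N : R := \sum_(1 <= n < N.+1) n%:R^-1.

Lemma harmonic_sumS N : harmonic_sum N.+1 = harmonic_sum N + N.+1%:R^-1.
Proof. by rewrite /harmonic_sum big_nat_recr. Qed.

(** Here g is Euler's constant, obtained as the infimum of the decreasing H_N - ln N; the increasing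
    H_N - ln(N+1) stays below it. *)
Lemma harmonic_sum_asymp : exists2 g : R, 0 <= g <= 1 &
  forall N, (0 < N)%N ->
    ln N%:R + g <= harmonic_sum N <= ln N%:R + g + N%:R^-1.
Proof.
pose u N := harmonic_sum N - ln N%:R; pose v N := harmonic_sum N - ln N.+1%:R.
have vu N : v N <= u N.
  rewrite /u /v lerD2l lerN2; case: N => [|N]; first by rewrite ln0 ?ln1.
  by rewrite ler_ln ?posrE ?ltr0n // ler_nat.
have uS N : (0 < N)%N -> u N.+1 <= u N.
  move=> N0; rewrite /u harmonic_sumS; have := ln_succ_ge N0.
  by move: (N.+1%:R^-1) (ln N.+1%:R) (ln N%:R) (harmonic_sum N) => a b c e; lra.
have vS N : v N <= v N.+1.
  rewrite /v harmonic_sumS; have := @ln_succ_le N.+1 isT.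
  by move: (N.+1%:R^-1) (ln N.+1%:R) (ln N.+2%:R) (harmonic_sum N) => a b c e; lra.
have u_dec M N : (0 < M <= N)%N -> u N <= u M.
  move=> /andP[M0]; elim: N => [|N IH]; first by rewrite leqn0 => /eqP->.
  rewrite leq_eqVlt => /predU1P[->//|]; rewrite ltnS => MN.
  by apply: le_trans (IH MN); apply: uS; lia.
have v_inc M N : (M <= N)%N -> v M <= v N.
  elim: N => [|N IH]; first by rewrite leqn0 => /eqP->.
  rewrite leq_eqVlt => /predU1P[->//|]; rewrite ltnS => MN.
  exact: le_trans (IH MN) (vS N).
have vu' N M : (0 < M)%N -> v N <= u M.
  move=> M0; have [NM|MN] := leqP N M; first exact: le_trans (v_inc _ _ NM) (vu M).
  by apply: le_trans (vu N) _; apply: u_dec; rewrite M0 ltnW.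
pose E : set R := [set u N | N in [set N | (0 < N)%N]]%classic.
have E0 : (E !=set0)%classic by exists (u 1%N); exists 1%N.
have Elb N : lbound E (v N) by move=> _ [M M0 <-]; exact: vu'.
have El : has_lbound E by exists (v 0%N); exact: Elb.
exists (inf E).
  apply/andP; split.
    apply: le_trans (lb_le_inf E0 (Elb 1%N)); rewrite /v /harmonic_sum big_nat1.
    by have := @ln_succ_le 1 isT; rewrite ln1; lra.
  apply: le_trans (ge_inf El _) _; first by exists 1%N.
  by rewrite /u /harmonic_sum big_nat1 ln1; lra.
move=> N N0; apply/andP; split.
  suff: inf E <= u N by rewrite /u; lra.
  by apply: ge_inf => //; exists N.
have : v N <= inf E by apply: lb_le_inf.
by have := ln_succ_le N0; rewrite /v; lra.
Qed.

Definition psi_nat N : R := \sum_(1 <= n < N.+1) Lambda n.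

Lemma psi_nat_ge0 N : 0 <= psi_nat N.
Proof. by apply: sumr_ge0 => n _; exact: mangoldt_ge0. Qed.

Lemma psi_nat_le M N : (M <= N)%N -> psi_nat M <= psi_nat N.
Proof.
move=> MN; rewrite /psi_nat [leRHS](@big_cat_nat _ _ _ M.+1) //= lerDl.
by apply: sumr_ge0 => n _; exact: mangoldt_ge0.
Qed.

(* The coefficient floor(N/n) - 2 floor(floor(N/2)/n) is 1 for N/2 < n <= N. *)
Lemma psi_nat_half N : psi_nat N - psi_nat (N %/ 2) <= ln (N`!)%:R - 2 * ln ((N %/ 2)`!)%:R.
Proof.
have hN : (N %/ 2 <= N)%N := leq_div _ _.
have -> : ln ((N %/ 2)`!)%:R = \sum_(1 <= n < N.+1) Lambda n * (N %/ 2 %/ n)%:R :> R.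
  rewrite ln_fact_mangoldt [RHS](@big_cat_nat _ _ _ (N %/ 2).+1) //= [X in _ + X]big1_seq ?addr0 //.
  by move=> n; rewrite mem_index_iota => /andP[_ /andP[hn _]]; rewrite divn_small // mulr0.
rewrite ln_fact_mangoldt mulr_sumr -sumrB.
have -> : psi_nat N - psi_nat (N %/ 2) = \sum_(1 <= n < N.+1) Lambda n * (N %/ 2 < n)%N%:R.
  rewrite /psi_nat (@big_cat_nat _ _ _ (N %/ 2).+1) //= addrAC subrr add0r.
  rewrite [RHS](@big_cat_nat _ _ _ (N %/ 2).+1) //= [X in _ = X + _]big1_seq ?add0r; last first.
    by move=> n; rewrite mem_index_iota => /andP[_ /andP[_]]; rewrite ltnNge => /negbTE->; rewrite mulr0.
  by apply: eq_big_nat => n /andP[-> _]; rewrite mulr1.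
apply: ler_sum_nat => n /andP[n0 nN].
rewrite mulrCA -mulrBr ler_wpM2l ?mangoldt_ge0 // lerBrDr -natrM -natrD ler_nat.
have -> : (N %/ 2 %/ n = N %/ n %/ 2)%N by rewrite -!divnMA mulnC.
have h1 : ((N %/ n) %/ 2 * 2 <= N %/ n)%N := leq_divM _ _.
case: ltnP => hn /=; last by lia.
have -> : (N %/ n = 1)%N.
  have : (N %/ n < 2)%N by rewrite ltn_divLR //; lia.
  have : (0 < N %/ n)%N by rewrite divn_gt0.
  lia.
by [].
Qed.

(** Chebyshev's bound by strong induction from floor(N/2) to N: [ln_fact_bounds] makes the increment
    in [psi_nat_half] linear in N. *)
Lemma psi_nat_linear N : psi_nat N <= 8 * N%:R.
Proof.
elim/ltn_ind: N => N IH.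
have [N1|N1] := leqP N 1.
  have : N = 0%N \/ N = 1%N by lia.
  case=> ->; rewrite /psi_nat; first by rewrite big_geq // mulr0.
  by rewrite big_nat1; have := @mangoldt_le R 1; rewrite ln1; lra.
set h := (N %/ 2)%N.
have h0 : (0 < h)%N by rewrite divn_gt0.
have hN : (h < N)%N by rewrite ltn_Pdiv //; lia.
have h1 : (2 * h <= N <= 2 * h + 1)%N by rewrite /h; lia.
have := IH h hN; have := psi_nat_half N; rewrite -/h.
have /andP[t1 t2] := @ln_fact_bounds N (ltnW N1).
have /andP[s1 s2] := ln_fact_bounds h0.
have hR : 1 <= h%:R :> R by rewrite ler1n.
have NR : 2 <= N%:R :> R by rewrite (ler_nat _ 2).
have [hN1 hN2] : 2 * h%:R <= N%:R :> R /\ N%:R <= 2 * h%:R + 1 :> R.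
  by move/andP: h1 => []; rewrite -!(ler_nat R) natrD natrM.
have l3 : ln (3 : R) <= 2 by apply: le_trans (ln_le_subr1 _) _; lra.
have lh : ln N%:R - 2 <= ln h%:R :> R.
  have : ln N%:R <= ln (3 * h%:R) :> R by rewrite ler_ln ?posrE; lra.
  rewrite lnM ?posrE; lra.
have lh0 : 0 <= ln h%:R :> R by rewrite ln_ge0.
have lN : ln N%:R <= N%:R - 1 :> R by apply: ln_le_subr1; lra.
nra.
Qed.

Definition mertens_sum N : R := \sum_(1 <= n < N.+1) Lambda n / n%:R.

(** Replacing floor(N/n) by N/n in [ln_fact_mangoldt] costs at most psi(N) <= 8N; then divide by
    N. *)
Lemma mertens N : (0 < N)%N -> ln N%:R - 1 <= mertens_sum N <= ln N%:R + 8.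
Proof.
move=> N0; have NR : 1 <= N%:R :> R by rewrite ler1n.
have /andP[t1 t2] := ln_fact_bounds N0.
have lN : ln N%:R <= N%:R - 1 :> R by apply: ln_le_subr1; lra.
have hd n : (0 < n)%N -> N%:R / n%:R - 1 <= ((N %/ n)%:R : R) <= N%:R / n%:R.
  move=> n0; have nR : 0 < n%:R :> R by rewrite ltr0n.
  rewrite lerBlDr natr1 ler_pdivlMr // ler_pdivrMr // -!natrM !ler_nat leq_divM andbT.
  by rewrite ltnW // ltn_ceil.
have e1 : N%:R * mertens_sum N = \sum_(1 <= n < N.+1) Lambda n * (N%:R / n%:R).
  by rewrite mulr_sumr; apply: eq_bigr => n _; rewrite mulrCA.
have m1 : ln (N`!)%:R <= N%:R * mertens_sum N.
  rewrite e1 ln_fact_mangoldt; apply: ler_sum_nat => n /andP[n0 _].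
  by rewrite ler_wpM2l ?mangoldt_ge0 //; have /andP[] := hd n n0.
have m2 : N%:R * mertens_sum N - psi_nat N <= ln (N`!)%:R.
  rewrite e1 ln_fact_mangoldt -sumrB; apply: ler_sum_nat => n /andP[n0 _].
  by rewrite -[X in _ - X]mulr1 -mulrBr ler_wpM2l ?mangoldt_ge0 //; have /andP[] := hd n n0.
have := psi_nat_linear N => pN.
by apply/andP; split; rewrite -(@ler_pM2l _ N%:R) //; nra.
Qed.

Lemma sum_hyperbola_swap (g : nat -> nat -> R) k :
  \sum_(1 <= m < k.+1) \sum_(1 <= j < (k %/ m).+1) g m j
  = \sum_(1 <= j < k.+1) \sum_(1 <= m < (k %/ j).+1) g m j.
Proof.
have E (f : nat -> nat -> R) m : (0 < m)%N ->
    \sum_(1 <= j < (k %/ m).+1) f m j = \sum_(1 <= j < k.+1 | (m * j <= k)%N) f m j.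
  move=> m0; rewrite [RHS]big_mkcond [RHS](@big_cat_nat _ _ _ (k %/ m).+1) //=; last first.
    by rewrite ltnS leq_div.
  rewrite [X in _ = _ + X]big1_seq ?addr0; last first.
    move=> j; rewrite mem_index_iota => /andP[_ /andP[h _]]; case: ifP => //.
    by rewrite mulnC -leq_divRL // leqNgt h.
  by apply: eq_big_nat => j /andP[_ jk]; rewrite mulnC -leq_divRL // -ltnS jk.
transitivity (\sum_(1 <= m < k.+1) \sum_(1 <= j < k.+1 | (m * j <= k)%N) g m j).
  by apply: eq_big_nat => m /andP[m0 _]; exact: E.
rewrite (exchange_big_dep_nat xpredT) //=.
apply: eq_big_nat => j /andP[j0 _]; rewrite (E (fun j m => g m j)) //.
by apply: eq_bigl => m; rewrite mulnC.
Qed.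

Lemma sum_psi_nat_div k : \sum_(1 <= m < k.+1) psi_nat (k %/ m) = ln (k`!)%:R.
Proof.
rewrite /psi_nat (sum_hyperbola_swap (fun _ j => Lambda j)) ln_fact_mangoldt.
by apply: eq_bigr => j _; rewrite sumr_const_nat subn1 /= mulr_natr.
Qed.

Lemma sum_invsqrt N : \sum_(1 <= d < N.+1) (Num.sqrt d%:R)^-1 <= 2 * Num.sqrt N%:R :> R.
Proof.
elim: N => [|N IH]; first by rewrite big_geq // sqrtr0 mulr0.
rewrite big_nat_recr //=.
set a := Num.sqrt N%:R in IH *; set b := Num.sqrt N.+1%:R.
have a0 : 0 <= a by rewrite sqrtr_ge0.
have b0 : 0 < b by rewrite sqrtr_gt0 ltr0n.
have ab : b ^+ 2 = a ^+ 2 + 1 by rewrite !sqr_sqrtr ?ler0n // natr1.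
have : b^-1 <= 2 * (b - a).
  by rewrite -[b^-1]mul1r ler_pdivrMr //; nra.
move: IH; rewrite -/a; lra.
Qed.

(** The substitution y = u^4 reduces this to ln u <= u - 1. *)
Lemma ln_sqr_le_sqrt (y : R) : 1 <= y -> ln y * (3 + ln y) <= 28 * Num.sqrt y.
Proof.
move=> y1; set s := Num.sqrt y; set u := Num.sqrt s.
have s0 : 0 <= s by exact: sqrtr_ge0.
have u0 : 0 <= u by exact: sqrtr_ge0.
have us : u ^+ 2 = s by rewrite sqr_sqrtr.
have uy : u ^+ 4 = y by rewrite (exprM u 2 2) us sqr_sqrtr //; lra.
have u1 : 1 <= u by rewrite -(@ler_pXn2r _ 4) ?nnegrE // uy expr1n.
have ly : ln y = 4 * ln u by rewrite -uy lnXn ?mulr_natl //; lra.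
have l0 : 0 <= ln u by rewrite ln_ge0.
have lu : ln u <= u - 1 by apply: ln_le_subr1; lra.
rewrite ly -us; nra.
Qed.

(** With y = N/d and k = floor(y) the sum is ln k! - y H_k + (g+1)k. The constant g + 1 is chosen so
    that the main terms cancel up to (y - k)(ln k + g). *)
Lemma selberg_remainder N (g : R) : (0 < N)%N -> 0 <= g <= 1 ->
  (forall k, (0 < k)%N -> ln k%:R + g <= harmonic_sum k <= ln k%:R + g + k%:R^-1) ->
  forall d, (0 < d <= N)%N ->
  `|\sum_(1 <= m < (N %/ d).+1) (psi_nat (N %/ (d * m)) - N%:R / (d * m)%:R + (g + 1))|
    <= 3 + ln (N%:R / d%:R).
Proof.
move=> N0 g01 Hg d /andP[d0 dN]; set k := (N %/ d)%N; set y : R := N%:R / d%:R.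
have k0 : (0 < k)%N by rewrite divn_gt0.
have dR : 0 < d%:R :> R by rewrite ltr0n.
have ky : k%:R <= y by rewrite ler_pdivlMr // -natrM ler_nat leq_divM.
have yk : y <= k%:R + 1 by rewrite ler_pdivrMr // natr1 -natrM ler_nat ltnW // ltn_ceil.
have -> : \sum_(1 <= m < k.+1) (psi_nat (N %/ (d * m)) - N%:R / (d * m)%:R + (g + 1))
   = ln (k`!)%:R - y * harmonic_sum k + (g + 1) * k%:R.
  rewrite big_split /= sumrB sumr_const_nat subn1 /= mulr_natr; congr (_ - _ + _).
    by rewrite -sum_psi_nat_div; apply: eq_bigr => m _; rewrite divnMA.
  rewrite /harmonic_sum mulr_sumr; apply: eq_bigr => m _.
  by rewrite natrM invfM mulrA.
have /andP[t1 t2] := ln_fact_bounds k0; have /andP[h1 h2] := Hg k k0.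
have kR : 1 <= k%:R :> R by rewrite ler1n.
have l0 : 0 <= ln k%:R :> R by rewrite ln_ge0.
have lky : ln k%:R <= ln y by rewrite ler_ln ?posrE; lra.
have yk1 : y / k%:R <= 2 by rewrite ler_pdivrMr; lra.
have Hy1 : y * (ln k%:R + g) <= y * harmonic_sum k by rewrite ler_wpM2l //; lra.
have Hy2 : y * harmonic_sum k <= y * (ln k%:R + g) + 2.
  by apply: le_trans (ler_wpM2l _ h2) _; [lra | rewrite mulrDr; lra].
have m1 : 0 <= (y - k%:R) * (ln k%:R + g) by apply: mulr_ge0; lra.
have m2 : (y - k%:R) * (ln k%:R + g) <= 1 * (ln k%:R + g) by apply: ler_wpM2r; lra.
rewrite ler_norml; apply/andP; split; lra.
Qed.

(** In [tatuzawa_iseki] the left side is O(N) by [selberg_remainder]; on the right, Mertens and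
    Chebyshev turn the contributions of N/n and g + 1 into -2 N ln N + O(N). *)
Lemma selberg N : (0 < N)%N ->
  `|psi_nat N * ln N%:R + \sum_(1 <= n < N.+1) Lambda n * psi_nat (N %/ n)
     - 2 * N%:R * ln N%:R| <= 100 * N%:R.
Proof.
move=> N0; have [g g01 Hg] := harmonic_sum_asymp.
have NR : 1 <= N%:R :> R by rewrite ler1n.
pose f n : R := psi_nat (N %/ n) - N%:R / n%:R + (g + 1).
have := tatuzawa_iseki f N0.
set S := (X in X = _ -> _) => SE.
have : `|S| <= 56 * N%:R.
  apply: le_trans (ler_norm_sum _ _ _) _.
  (* The logarithmic factors are bounded by 28 sqrt(N/d), whose sum over d is at most 56 N. *)
  apply: le_trans (_ : \sum_(1 <= d < N.+1) 28 * Num.sqrt N%:R * (Num.sqrt d%:R)^-1 <= _).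
    apply: ler_sum_nat => d /andP[d0 dN].
    have y1 : 1 <= N%:R / d%:R :> R by rewrite ler_pdivlMr ?ltr0n // mul1r ler_nat.
    rewrite !normrM [`|ln _|]ger0_norm ?ln_ge0 //.
    apply: le_trans (_ : ln (N%:R / d%:R) * (3 + ln (N%:R / d%:R)) <= _).
      apply: ler_pM => //; first by rewrite mulr_ge0 ?ln_ge0.
        rewrite -[leRHS]mul1r ler_wpM2r ?ln_ge0 // -intr_norm.
        by rewrite -[1]/(1%:~R) ler_int normr_moebius.
      by apply: selberg_remainder; rewrite ?d0.
    apply: le_trans (ln_sqr_le_sqrt y1) _.
    by rewrite sqrtrM ?ler0n // sqrtrV ?ler0n // mulrA.
  rewrite -mulr_sumr; apply: le_trans (ler_wpM2l _ (sum_invsqrt N)) _.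
    by rewrite mulr_ge0 ?sqrtr_ge0.
  have := @sqr_sqrtr R N%:R (ler0n _ _); rewrite expr2; nra.
rewrite SE; set T := (X in _ + X).
have -> : T = \sum_(1 <= n < N.+1) Lambda n * psi_nat (N %/ n) - N%:R * mertens_sum N + (g + 1) * psi_nat N.
  rewrite /T /mertens_sum [psi_nat N]/psi_nat !mulr_sumr -sumrB -big_split /=; apply: eq_bigr => n _.
  by rewrite /f; ring.
have -> : f 1%N = psi_nat N - N%:R + (g + 1) by rewrite /f divn1 divr1.
set U := \sum_(1 <= n < N.+1) _.
have /andP[m1 m2] := mertens N0; have p1 := psi_nat_linear N; have p0 := psi_nat_ge0 N.
have lN : ln N%:R <= N%:R - 1 :> R by apply: ln_le_subr1; lra.
have l0 : 0 <= ln N%:R :> R by rewrite ln_ge0.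
have M1 : N%:R * mertens_sum N <= N%:R * (ln N%:R + 8) by apply: ler_wpM2l; lra.
have M2 : N%:R * (ln N%:R - 1) <= N%:R * mertens_sum N by apply: ler_wpM2l; lra.
have g1 : 0 <= (g + 1) * psi_nat N <= 2 * psi_nat N.
  by apply/andP; split; [apply: mulr_ge0 | apply: ler_wpM2r]; lra.
have g2 : 0 <= (g + 1) * ln N%:R <= 2 * ln N%:R.
  by apply/andP; split; [apply: mulr_ge0 | apply: ler_wpM2r]; lra.
rewrite !ler_norml => /andP[a1 a2]; apply/andP; split; lra.
Qed.

End Estimates.

(** * Real arguments, and consequences of Selberg's formula for intervals *)

Section RealVariable.
Variable R : realType.
Implicit Types (F G : nat -> R) (a b c x y : R).
Local Notation Lambda := (@mangoldt R).

(** For a >= 0 the index runs over the integers in (a, b]. *)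
Definition isum F a b := \sum_((Num.truncn a).+1 <= n < (Num.truncn b).+1) F n.

Lemma isum_cat F a b c : a <= b -> b <= c -> isum F a c = isum F a b + isum F b c.
Proof. by move=> ab bc; rewrite /isum -big_cat_nat // ltnS le_truncn. Qed.

Lemma mem_isum a b n : (Num.truncn a < n < (Num.truncn b).+1)%N -> a < n%:R <= b.
Proof. by case: n => // n; rewrite !ltnS truncn_le_nat truncn_gt_nat. Qed.

Lemma ler_isum F G a b : (forall n, a < n%:R <= b -> F n <= G n) -> isum F a b <= isum G a b.
Proof. by move=> h; apply: ler_sum_nat => n /mem_isum; exact: h. Qed.

Lemma isum_ge0 F a b : (forall n, a < n%:R <= b -> 0 <= F n) -> 0 <= isum F a b.
Proof.
by move=> h; rewrite /isum big_seq; apply: sumr_ge0 => n; rewrite mem_index_iota => /mem_isum; exact: h.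
Qed.

Lemma isumZ k F a b : isum (fun n => k * F n) a b = k * isum F a b.
Proof. by rewrite /isum mulr_sumr. Qed.

Lemma isumB F G a b : isum (fun n => F n - G n) a b = isum F a b - isum G a b.
Proof. by rewrite /isum sumrB. Qed.

Definition psi x : R := psi_nat R (Num.truncn x).
Definition mertens_real x : R := mertens_sum R (Num.truncn x).

Lemma psiE x : psi x = isum Lambda 0 x.
Proof. by rewrite /psi /psi_nat /isum truncn0. Qed.

Lemma mertens_realE x : mertens_real x = isum (fun n => Lambda n / n%:R) 0 x.
Proof. by rewrite /mertens_real /mertens_sum /isum truncn0. Qed.

Lemma psiB a b : 0 <= a -> a <= b -> psi b - psi a = isum Lambda a b.
Proof. by move=> a0 ab; rewrite !psiE (isum_cat _ a0 ab) addrAC subrr add0r. Qed.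

Lemma mertens_realB a b : 0 <= a -> a <= b ->
  mertens_real b - mertens_real a = isum (fun n => Lambda n / n%:R) a b.
Proof. by move=> a0 ab; rewrite !mertens_realE (isum_cat _ a0 ab) addrAC subrr add0r. Qed.

Lemma psi_ge0 x : 0 <= psi x. Proof. exact: psi_nat_ge0. Qed.

Lemma psi_le a b : a <= b -> psi a <= psi b.
Proof. by move=> ab; apply: psi_nat_le; exact: le_truncn. Qed.

Lemma psi_linear x : 0 <= x -> psi x <= 8 * x.
Proof.
move=> x0; apply: le_trans (psi_nat_linear _ _) _.
by rewrite ler_wpM2l // truncn_le.
Qed.

Lemma truncn_divn x n : 0 <= x -> (0 < n)%N -> Num.truncn (x / n%:R) = (Num.truncn x %/ n)%N.
Proof.
move=> x0 n0; apply: truncn_def; have nR : 0 < n%:R :> R by rewrite ltr0n.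
have /andP[h1 h2] := truncn_itv x0.
rewrite ler_pdivlMr // ltr_pdivrMr // -!natrM; apply/andP; split.
  by apply: le_trans h1; rewrite ler_nat leq_divM.
by apply: lt_le_trans h2 _; rewrite ler_nat ltn_ceil.
Qed.

Lemma ln_truncn x : 1 <= x ->
  [/\ (0 < Num.truncn x)%N, ln (Num.truncn x)%:R <= ln x &
      (Num.truncn x)%:R * (ln x - ln (Num.truncn x)%:R) <= 1].
Proof.
move=> x1; have x0 : 0 <= x by lra.
have N0 : (0 < Num.truncn x)%N by rewrite truncn_gt0.
have /andP[h1 h2] := truncn_itv x0; set N := Num.truncn x in N0 h1 h2 *.
have NR : 1 <= N%:R :> R by rewrite ler1n.
split=> //; first by rewrite ler_ln ?posrE; lra.
have := @ln_succ_le R _ N0.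
have : ln x <= ln N.+1%:R by rewrite ler_ln ?posrE; lra.
move=> h3 h4; have h5 : ln x - ln N%:R <= N%:R^-1 by lra.
have N0' : 0 <= N%:R :> R by lra.
by have := ler_wpM2l N0' h5; rewrite mulfV // gt_eqF; lra.
Qed.

Lemma mertens_real_bounds x : 1 <= x -> ln x - 2 <= mertens_real x <= ln x + 8.
Proof.
move=> /ln_truncn[N0]; rewrite /mertens_real; set N := Num.truncn x in N0 * => h1 h2.
have /andP[m1 m2] := mertens R N0.
have NR : 1 <= N%:R :> R by rewrite ler1n.
apply/andP; split; nra.
Qed.

Lemma mertens_realB_bounds a b : 1 <= a -> a <= b ->
  ln b - ln a - 10 <= mertens_real b - mertens_real a <= ln b - ln a + 10.
Proof.
move=> a1 ab; have b1 : 1 <= b by lra.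
by have /andP[? ?] := mertens_real_bounds a1; have /andP[? ?] := mertens_real_bounds b1; apply/andP; split; lra.
Qed.

Lemma mertens_realB_psi a b : 0 < a -> a <= b ->
  (psi b - psi a) / b <= mertens_real b - mertens_real a <= (psi b - psi a) / a.
Proof.
move=> a0 ab; have b0 : 0 < b by lra.
rewrite psiB ?mertens_realB ?(ltW a0) // ![_ / _]mulrC -!isumZ.
apply/andP; split; apply: ler_isum => n /andP[an nb].
  by rewrite mulrC; apply: ler_wpM2l; rewrite ?mangoldt_ge0 // lef_pV2 ?posrE; lra.
by rewrite mulrC; apply: ler_wpM2r; rewrite ?mangoldt_ge0 // lef_pV2 ?posrE; lra.
Qed.

Lemma selberg_real x : 1 <= x ->
  `|psi x * ln x + isum (fun n => Lambda n * psi (x / n%:R)) 0 x - 2 * x * ln x| <= 110 * x.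
Proof.
move=> x1; have x0 : 0 <= x by lra.
have [N0 l1 l2] := ln_truncn x1; have /andP[h1 h2] := truncn_itv x0.
rewrite /isum truncn0; set N := Num.truncn x in N0 l1 l2 h1 h2 *.
have -> : \sum_(1 <= n < N.+1) Lambda n * psi (x / n%:R) = \sum_(1 <= n < N.+1) Lambda n * psi_nat R (N %/ n).
  by apply: eq_big_nat => n /andP[n0 _]; rewrite /psi truncn_divn.
have := selberg R N0; set S := \sum_(1 <= n < N.+1) _.
rewrite /psi -/N; have p0 := psi_nat_ge0 R N; have p8 := psi_nat_linear R N.
have NR : 1 <= N%:R :> R by rewrite ler1n.
have p : 0 <= psi_nat R N * (ln x - ln N%:R) <= 8.
  apply/andP; split; first by apply: mulr_ge0 => //; lra.
  apply: le_trans (_ : 8 * N%:R * (ln x - ln N%:R) <= _); last by rewrite -mulrA; lra.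
  by apply: ler_wpM2r => //; lra.
have lx : ln x <= x - 1 by apply: ln_le_subr1; lra.
have lx0 : 0 <= ln x by rewrite ln_ge0.
have q : 0 <= x * ln x - N%:R * ln N%:R <= ln x + 1.
  have e : x * ln x - N%:R * ln N%:R = (x - N%:R) * ln x + N%:R * (ln x - ln N%:R) by ring.
  rewrite e; have : 0 <= N%:R * (ln x - ln N%:R) by apply: mulr_ge0; lra.
  have : 0 <= (x - N%:R) * ln x by apply: mulr_ge0; lra.
  have : (x - N%:R) * ln x <= 1 * ln x by apply: ler_wpM2r => //; rewrite -natr1 in h2; lra.
  by move=> *; apply/andP; split; lra.
rewrite !ler_norml => /andP[a1 a2]; apply/andP; split; lra.
Qed.

(** Subtract Selberg's formula at a from that at b. The convolution sum increases with its argument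
    and is dropped; replacing ln a by ln b costs at most 2(b - a). *)
Lemma selberg_upper a b : 1 <= a -> a <= b ->
  (psi b - psi a) * ln b <= 2 * (b - a) * ln b + 222 * b.
Proof.
move=> a1 ab; have b1 : 1 <= b by lra.
have := selberg_real a1; have := selberg_real b1; rewrite !ler_norml => /andP[_ hb] /andP[ha _].
have a0 : 0 <= a by lra.
have hs : isum (fun n => Lambda n * psi (a / n%:R)) 0 a <= isum (fun n => Lambda n * psi (b / n%:R)) 0 b.
  rewrite (isum_cat _ a0 ab) -[leLHS]addr0; apply: lerD.
    apply: ler_isum => n /andP[n0 _]; rewrite ler_wpM2l ?mangoldt_ge0 // psi_le //.
    by rewrite ler_wpM2r // invr_ge0; lra.
  by apply: isum_ge0 => n _; rewrite mulr_ge0 ?mangoldt_ge0 ?psi_ge0.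
have la : ln a <= ln b by rewrite ler_ln ?posrE; lra.
have pa : 0 <= psi a * (ln b - ln a) by apply: mulr_ge0; [exact: psi_ge0 | lra].
have lab : a * (ln b - ln a) <= b - a.
  rewrite -ln_div ?posrE; [|lra|lra].
  have /(ler_wpM2l a0) : ln (b / a) <= b / a - 1.
    by apply: ln_le_subr1; rewrite divr_gt0; lra.
  by rewrite mulrBr mulrCA mulfV ?gt_eqF; lra.
lra.
Qed.

Lemma psiB_upper (eta : R) : 0 < eta -> exists2 y0 : R, 1 <= y0 &
  forall a b, 1 <= a -> a <= b -> y0 <= b -> psi b - psi a <= 2 * (b - a) + eta * b.
Proof.
(* Beyond this point 222 / ln b <= eta. *)
move=> e0; exists (expR (222 / eta)).
  have : 0 < 222 / eta by apply: divr_gt0; lra.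
  by have := @expR_ge1Dx R (222 / eta); lra.
move=> a b a1 ab yb; have b0 : 0 < b by lra.
have lb : 222 / eta <= ln b by rewrite -ler_expR lnK.
have lb0 : 0 < ln b by apply: lt_le_trans lb; apply: divr_gt0; lra.
rewrite -(ler_pM2r lb0); apply: le_trans (selberg_upper a1 ab) _.
have : 222 * b <= eta * ln b * b.
  by rewrite ler_wpM2r ?(ltW b0) //; move: lb; rewrite ler_pdivrMr // mulrC.
lra.
Qed.

(** Difference of Selberg's formula at l x and at x. The terms with x < n <= l x are O(x), because
    psi(l x/n) <= 8 l there. *)
Lemma selberg_ratio_lower l : 1 <= l -> exists C : R, forall x, 1 <= x ->
  2 * (l - 1) * x * ln x - (psi (l * x) - psi x) * ln x - C * x
  <= isum (fun n => Lambda n * (psi (l * (x / n%:R)) - psi (x / n%:R))) 0 x.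
Proof.
move=> l1; exists (110 * (l + 1) + 8 * l * ln l + 64 * l ^+ 2) => x x1.
have x0 : 0 <= x by lra.
have xl : x <= l * x by rewrite -[leLHS]mul1r ler_wpM2r.
have lx1 : 1 <= l * x by lra.
have := selberg_real lx1; have := selberg_real x1; rewrite !ler_norml => /andP[_ ha] /andP[hb _].
under [X in _ <= X]eq_bigr do rewrite mulrBr.
rewrite -/(isum _ _ _) isumB.
have e1 : isum (fun n => Lambda n * psi (l * (x / n%:R))) 0 x =
  isum (fun n => Lambda n * psi (l * x / n%:R)) 0 x by apply: eq_bigr => n _; rewrite mulrA.
rewrite e1; rewrite (isum_cat _ x0 xl) in hb.
have h1 : isum (fun n => Lambda n * psi (l * x / n%:R)) x (l * x) <= 64 * l ^+ 2 * x.
  apply: le_trans (_ : isum (fun n => 8 * l * Lambda n) x (l * x) <= _).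
    apply: ler_isum => n /andP[xn _]; rewrite mulrC ler_wpM2r ?mangoldt_ge0 //.
    have n0 : 0 < n%:R :> R by lra.
    apply: le_trans (psi_linear _) _; first by rewrite divr_ge0; lra.
    by rewrite -!mulrA ler_wpM2l // -[leRHS]mulr1 ler_wpM2l ?ler_pdivrMr; lra.
  rewrite isumZ -psiB //; have := psi_linear (le_trans x0 xl); have := psi_ge0 x.
  set p := psi (l * x); set q := psi x => q0 p8.
  have : 8 * l * (p - q) <= 8 * l * (8 * (l * x)) by apply: ler_wpM2l; lra.
  by rewrite expr2; lra.
rewrite lnM ?posrE in hb; [|lra|lra].
have ll : 0 <= ln l by rewrite ln_ge0.
have h2 : psi (l * x) * ln l <= 8 * l * ln l * x.
  have := ler_wpM2r ll (psi_linear (le_trans x0 xl)); lra.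
have h3 : 0 <= l * x * ln l by apply: mulr_ge0; lra.
lra.
Qed.

(** The property whose threshold in l is studied: it is monotone in l, follows from Mertens' theorem
    for large l, and is finally proved for all l > 1. *)
Definition prime_dense l := exists2 d : R, 0 < d &
  exists x0 : R, forall x, x0 <= x -> d * x <= psi (l * x) - psi x.

Lemma prime_dense_le l l' : l <= l' -> prime_dense l -> prime_dense l'.
Proof.
move=> ll' [d d0 [x0 h]]; exists d => //; exists (Num.max x0 0) => x.
rewrite ge_max => /andP[xx0 x0']; apply: le_trans (h x xx0) _.
by rewrite lerD2r psi_le // ler_wpM2r.
Qed.

(** The Mertens sum over (x, e^11 x] is at least 11 - 10 = 1, and each weight 1/n there is below
    1/x. *)
Lemma prime_dense_large l : expR 11 <= l -> prime_dense l.
Proof.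
move=> hl; apply: prime_dense_le hl _; set l0 := expR 11.
have l01 : 1 <= l0 by have := @expR_ge1Dx R 11; rewrite /l0; lra.
exists 1 => //; exists 1 => x x1; have x0 : 0 < x by lra.
have xl : x <= l0 * x by rewrite -[leLHS]mul1r ler_wpM2r; lra.
have /andP[_ h1] := mertens_realB_psi x0 xl; have /andP[h2 _] := mertens_realB_bounds x1 xl.
rewrite -ler_pdivlMr //; apply: le_trans h1; apply: le_trans h2.
by rewrite lnM ?posrE; [rewrite /l0 expRK; lra | lra | lra].
Qed.

End RealVariable.

(** * Primes in short intervals *)

Section ErdosArgument.
Variable R : realType.
Local Notation Lambda := (@mangoldt R).

Lemma sum_indicator_le1 (k b n : nat) : \sum_(b <= i < n) (i == k)%:R <= 1 :> R.
Proof.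
have [nb|bn] := leqP n b; first by rewrite big_geq.
suff: forall n, (b <= n)%N -> \sum_(b <= i < n) (i == k)%:R <= (k < n)%N%:R :> R.
  by move=> h; apply: le_trans (h n (ltnW bn)) _; case: (k < n)%N.
elim => [|j IH]; first by rewrite leqn0 => /eqP->; rewrite big_geq.
rewrite leq_eqVlt => /predU1P[<-|]; first by rewrite big_geq.
rewrite ltnS => bj; rewrite big_nat_recr //=; have := IH bj.
by rewrite ltnS; case: ltngtP => _ /=; lra.
Qed.

Lemma monotone_cell (t : nat -> R) (y : R) i k : t i <= y < t (i + k).+1 ->
  exists2 j, (i <= j <= i + k)%N & t j <= y < t j.+1.
Proof.
elim: k => [|k IH] /andP[h1 h2].
  by exists i; rewrite ?addn0 ?leqnn // h1 /=; rewrite addn0 in h2.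
have [h|h] := ltP y (t (i + k).+1).
  have [|j /andP[ij jk] hj] := IH; first by rewrite h1.
  by exists j => //; rewrite ij /= addnS leqW.
by exists (i + k.+1)%N; rewrite ?leqnn ?leq_addr // addnS h -addnS.
Qed.

(* On the grid w0 s^i a cell is called full if its prime density is almost 2.
   A nonfull cell i forces the cells i+2, ..., i+m-1 to be full, so that any m
   consecutive cells contain at least m-2 full ones. *)
Lemma full_cells_contradiction (s eta rho w0 : R) (m Q : nat) :
  1 < s <= 11 / 10 -> (20 <= m)%N -> 20 <= Q%:R * (m%:R * (s - 1)) ->
  rho + eta <= (s - 1) / 10 -> 0 <= eta -> 0 <= rho -> 1 <= w0 ->
  (forall a b, 1 <= a -> a <= b -> w0 <= b -> psi b - psi a <= 2 * (b - a) + eta * b) ->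
  (forall i, (i + m < (Q.+1 * m).+1)%N -> exists2 y,
      w0 * s ^+ i <= y < w0 * s ^+ (i + m).+1 &
      (2 * (s ^+ m - 1) + eta * s ^+ m - rho) * y <= psi (s ^+ m * y) - psi y) ->
  False.
Proof.
move=> /andP[s1 s2] m20 Q20 re e0 r0 w1 Hup Hgood.
have s0 : 0 < s by lra.
pose t i := w0 * s ^+ i.
have t1 i : 1 <= t i.
  by have := @exprn_ege1 _ i s (ltW s1); rewrite /t => h; rewrite -[leLHS]mulr1; apply: ler_pM; lra.
have tS i : t i.+1 = s * t i by rewrite /t exprS mulrCA.
have tle i j : (i <= j)%N -> t i <= t j.
  by move=> ij; rewrite /t ler_wpM2l ?ler_weXn2l //; lra.
have tw i : w0 <= t i by have := tle 0%N i isT; rewrite {1}/t expr0 mulr1.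
pose full i := 19 / 10 * (s - 1) * t i <= psi (t i.+1) - psi (t i).
(* Let y be an extremal point in cell j. Removing the upper bounds on (y, t_i'] and (t_(i'+1), s^m
   y] leaves density at least 2(s-1) - rho - eta on the cell i'. *)
have window i : (i + m < (Q.+1 * m).+1)%N -> exists2 j, (i <= j <= i + m)%N &
    forall i', (j < i' < j + m)%N -> full i'.
  move=> /Hgood[y hy good]; have [j hj /andP[jy yj]] := @monotone_cell t y i m hy.
  exists j => // i' /andP[ji ij].
  have ti : y <= t i' by apply: le_trans (ltW yj) (tle _ _ ji).
  have ti' : t i'.+1 <= s ^+ m * y.
    apply: le_trans (tle _ _ ij) _; rewrite /t exprD.
    by rewrite mulrA [_ * s ^+ m]mulrC ler_wpM2l ?exprn_ge0 // ltW.
  have y1 : 1 <= y by apply: le_trans jy.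
  have u1 := Hup y (t i') y1 ti (tw _).
  have u2 := Hup (t i'.+1) (s ^+ m * y) (t1 _) ti' (le_trans (tw _) ti').
  have : rho * y <= rho * t i' by apply: ler_wpM2l.
  have : 0 <= ((s - 1) / 10 - (rho + eta)) * t i' by apply: mulr_ge0; have := t1 i'; lra.
  rewrite /full; move: u1 u2 good; rewrite tS.
  move: (s ^+ m) (psi y) (psi (t i')) (psi (s * t i')) (t i') => l p q r v; lra.
pose g i := mertens_real (t i.+1) - mertens_real (t i).
pose c := 19 / 10 * (s - 1) / s.
have c0 : 0 <= c by rewrite /c divr_ge0; lra.
have tpos i : 0 < t i by have := t1 i; lra.
have g_lb i : (psi (t i.+1) - psi (t i)) / t i.+1 <= g i.
  by have /andP[] := mertens_realB_psi (tpos i) (tle _ _ (leqnSn i)).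
have g0 i : 0 <= g i.
  by apply: le_trans (g_lb i); rewrite divr_ge0 ?(ltW (tpos _)) // subr_ge0 psi_le ?tle.
have gfull i : full i -> c <= g i.
  move=> fi; apply: le_trans (g_lb i).
  rewrite ler_pdivlMr ?tpos //; apply: le_trans fi; rewrite tS.
  by rewrite /c mulrA divfK ?gt_eqF.
have block b : (m <= b)%N -> (b + m <= Q.+1 * m)%N ->
    (m%:R - 2) * c <= \sum_(b <= i < b + m) g i.
  move=> mb bm.
  have [i0 Hi0] : exists i0, forall i, (b <= i < b + m)%N -> i != i0 -> i != i0.+1 -> full i.
    have [[i hi]|none] := pselect (exists i, `[< (b <= i < b + m)%N /\ ~ full i >]); last first.
      exists 0%N => i hi _ _; apply: contrapT => nf; apply: none; exists i.
      exact/asboolP.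
    pose P k := `[< (b <= k < b + m)%N /\ ~ full k >].
    have exP : exists k, P k by exists i.
    have [i0 /asboolP[/andP[bi0 i0b] nf] imin] := ex_minnP exP.
    exists i0 => i' /andP[bi' i'b] n1 n2.
    have [lt|ge] := ltnP i' i0.
      apply: contrapT => nf'; have := imin i'; rewrite leqNgt lt => /(_ _)/negP; apply => //.
      by apply/asboolP; split=> //; rewrite bi'.
    (* For this window j < i0 would make the nonfull cell i0 full. So j is i0 or i0 + 1, and the
       cells of the block from i0 + 2 on are full. *)
    have [|j /andP[hj1 hj2] hj] := window (i0.+1 - m)%N; first by clear -bi0 i0b mb bm m20; lia.
    have ij : (i0 <= j)%N.
      by rewrite leqNgt; apply/negP => ji; apply: nf; apply: hj; clear -ji hj1 hj2 bi0 mb; lia.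
    by apply: hj; clear -n1 n2 ge ij i'b hj1 hj2 bi0 mb m20; lia.
  apply: le_trans (_ : \sum_(b <= i < b + m) (c - c * (i == i0)%:R - c * (i == i0.+1)%:R) <= _).
    rewrite !sumrB sumr_const_nat -!mulr_sumr -mulr_natr.
    rewrite addKn.
    have := ler_wpM2l c0 (sum_indicator_le1 i0 b (b + m)).
    have := ler_wpM2l c0 (sum_indicator_le1 i0.+1 b (b + m)); lra.
  apply: ler_sum_nat => i hi.
  have [e1|n1] := eqVneq i i0; first by have := g0 i; case: eqP => _ /=; lra.
  have [e2|n2] /= := eqVneq i i0.+1; first by have := g0 i; lra.
  by have := gfull i (Hi0 i hi n1 n2); lra.
have blocks q : (q <= Q)%N -> q%:R * ((m%:R - 2) * c) <= \sum_(m <= i < m + q * m) g i.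
  elim: q => [_|q IH qQ]; first by rewrite mul0r mul0n addn0 big_geq.
  rewrite (@big_cat_nat _ _ _ (m + q * m)) /= ?leq_addr ?leq_add2l ?leq_mul2r ?leqnSn ?orbT //.
  rewrite -natr1 mulrDl mul1r; apply: lerD; first by apply: IH; exact: ltnW.
  rewrite mulSnr addnA; apply: block; first exact: leq_addr.
  by rewrite -mulSn -mulSnr leq_mul2r ltnS qQ orbT.
(* The telescoped sum is at least 1.54 Q m (s-1) by the blocks, but at most Q m (s-1) + 10 by
   Mertens; this contradicts Q m (s-1) >= 20. *)
have := blocks Q (leqnn Q); rewrite telescope_sumr ?leq_addr //.
have /andP[_] := mertens_realB_bounds (t1 m) (tle _ _ (leq_addr (Q * m) m)).
have lnt i : ln (t i) = ln w0 + i%:R * ln s.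
  by rewrite /t lnM ?posrE ?exprn_gt0 ?lnXn ?mulr_natl //; lra.
rewrite !lnt natrD natrM.
have ls : ln s <= s - 1 by apply: ln_le_subr1.
have mR : 20 <= m%:R :> R by rewrite (ler_nat _ 20).
have QR : 0 <= Q%:R :> R by [].
have cl : 172 / 100 * (s - 1) <= c.
  rewrite /c ler_pdivlMr //.
  have := @ler_wpM2l _ (s - 1) _ s (11/10) s2; nra.
have mc : 154 / 100 * (m%:R * (s - 1)) <= (m%:R - 2) * c.
  apply: le_trans (_ : (m%:R - 2) * (172 / 100 * (s - 1)) <= _); last by apply: ler_wpM2l => //; lra.
  nra.
have QM : 0 <= Q%:R * m%:R :> R by rewrite mulr_ge0.
have h1 := ler_wpM2l QR mc; have h2 := ler_wpM2l QM ls.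
move: h1 h2; rewrite -/(t _); lra.
Qed.

End ErdosArgument.

(** * Nearly extremal intervals produced by a sparse one *)

Section ErdosArgument.
Variable R : realType.
Local Notation Lambda := (@mangoldt R).

Lemma expr_unbounded (K X : R) : 1 < K -> exists j, X <= K ^+ j.
Proof.
move=> K1; exists (Num.truncn (X / (K - 1))).+1.
have K0 : 0 < K - 1 by lra.
have h : X <= (Num.truncn (X / (K - 1))).+1%:R * (K - 1).
  by rewrite -ler_pdivrMr //; apply: ltW; exact: truncnS_gt.
apply: le_trans h _; set n := _.+1.
have -> : K = 1 + (K - 1) by lra.
rewrite [1 + _ - 1]addrC addKr; elim: n => [|n IH]; first by rewrite mul0r expr0.
rewrite exprS -natr1; have := @exprn_ege1 _ n (1 + (K - 1)); nra.
Qed.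

Lemma isum_restrict (F : nat -> R) (a b Y : R) : 0 <= a -> a <= b -> b <= Y ->
  (forall n, 0 < (n%:R : R) <= Y -> 0 <= F n) -> isum F a b <= isum F 0 Y.
Proof.
move=> a0 ab bY F0; rewrite (isum_cat _ (le_trans a0 ab) bY) (isum_cat _ a0 ab).
have part u v : 0 <= u -> v <= Y -> 0 <= isum F u v.
  move=> u0 vY; apply: isum_ge0 => n /andP[un nv]; apply: F0.
  by rewrite (le_lt_trans u0 un) (le_trans nv vY).
have b0 := le_trans a0 ab.
by rewrite addrAC lerDr addr_ge0 // part // (le_trans ab bY).
Qed.

(** Pigeonhole: about ln Y / ln K - j0 blocks (K^j, K^(j+1)] with j >= j0 fit below Y, and they
    cannot all carry beta. *)
Lemma small_block (F : nat -> R) (K beta Y : R) j0 : 1 < K -> 0 < beta -> 1 <= Y ->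
  (forall n, 0 < (n%:R : R) <= Y -> 0 <= F n) ->
  isum F 0 Y < (ln Y / ln K - 1 - j0%:R) * beta ->
  exists j, [/\ (j0 <= j)%N, K ^+ j.+1 <= Y & isum F (K ^+ j) (K ^+ j.+1) < beta].
Proof.
move=> K1 b0 Y1 F0 small; have K0 : 0 < K := lt_trans ltr01 K1.
have Y0 : 0 < Y := lt_le_trans ltr01 Y1.
have lK : 0 < ln K by rewrite ln_gt0.
have Kp i : 0 < K ^+ i by rewrite exprn_gt0.
have Kle i j : (i <= j)%N -> K ^+ i <= K ^+ j by move=> ij; rewrite ler_weXn2l ?(ltW K1).
have [J HJ1 HJ2] : exists2 J, K ^+ J <= Y & Y < K ^+ J.+1.
  have [N HN] := expr_unbounded Y K1.
  have := @monotone_cell R (fun i => K ^+ i) Y 0 N.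
  case; last by move=> J _ /andP[]; exists J.
  rewrite expr0 Y1 add0n exprS /=; apply: le_lt_trans HN _.
  by rewrite ltr_pMl.
apply: contrapT => none.
have big j : (j0 <= j)%N -> (j < J)%N -> beta <= isum F (K ^+ j) (K ^+ j.+1).
  move=> h1 h2; rewrite leNgt; apply/negP => h3; apply: none; exists j; split=> //.
  exact: le_trans (Kle _ _ h2) HJ1.
have sumb q : (q <= J)%N -> (q%:R - j0%:R) * beta <= isum F 0 (K ^+ q).
  elim: q => [|q IH] qJ.
    apply: le_trans (isum_ge0 _); last first.
      by move=> n /andP[n0 nK]; apply: F0; rewrite n0 (le_trans nK) // (le_trans _ HJ1) ?Kle.
    by rewrite pmulr_lle0 // subr_le0 ler0n.
  have [qj|jq] := ltnP q j0.
    apply: le_trans (isum_ge0 _); last first.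
      by move=> n /andP[n0 nK]; apply: F0; rewrite n0 (le_trans nK) // (le_trans _ HJ1) ?Kle.
    by rewrite pmulr_lle0 // subr_le0 ler_nat.
  rewrite (@isum_cat _ _ _ (K ^+ q)) ?(ltW (Kp q)) ?Kle // -natr1 addrAC mulrDl mul1r.
  by apply: lerD; [apply: IH; exact: ltnW | exact: big].
have := lt_le_trans (le_lt_trans (le_trans (sumb J (leqnn J))
  (isum_restrict (lexx 0) (ltW (Kp J)) HJ1 F0)) small) (lexx _).
rewrite ltr_pM2r // ltrD2r ltNge => /negP; apply.
rewrite lerBlDr natr1 ler_pdivrMr // mulr_natl -lnXn //.
by rewrite ler_ln ?posrE // ltW.
Qed.

(* The summand measures how far the density of (x/n, l x/n] stays below its
   maximum 2 + o(1).  If few primes lie in (x, l x], then Selberg's formula at x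
   makes the sum of the deficits small compared with ln x. *)
Definition deficit (l eta x : R) (n : nat) : R := Lambda n / n%:R *
  (2 * (l - 1) + eta * l - (psi (l * (x / n%:R)) - psi (x / n%:R)) / (x / n%:R)).

Lemma deficit_ge0 (l eta x y0 : R) n : 1 < l -> 1 <= y0 ->
  (forall a b, 1 <= a -> a <= b -> y0 <= b -> psi b - psi a <= 2 * (b - a) + eta * b) ->
  0 < (n%:R : R) <= x / y0 -> 0 <= deficit l eta x n.
Proof.
move=> l1 y01 Hy /andP[n0 nx]; have y0p := lt_le_trans ltr01 y01.
have yn : y0 <= x / n%:R by move: nx; rewrite ler_pdivlMr // ler_pdivlMr // mulrC.
have yn0 : 0 < x / n%:R := lt_le_trans y0p yn.
rewrite mulr_ge0 ?divr_ge0 ?mangoldt_ge0 // subr_ge0 ler_pdivrMr //.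
move: (x / n%:R) yn yn0 => y yn yn0.
have yl : y <= l * y by rewrite ler_peMl ?(ltW l1) ?(ltW yn0).
have := Hy y (l * y) (le_trans y01 yn) yl (le_trans yn yl).
by clear; lra.
Qed.

(** By Mertens the maximal densities sum to at most (2(l-1) + eta l)(ln x + 8); the actual ones sum
    to at least (2(l-1) - eta) ln x - C. The terms 2(l-1) ln x cancel. *)
Lemma deficit_sum_upper (l eta C x : R) : 1 < l -> 0 < eta -> 1 <= x ->
  2 * (l - 1) * x * ln x - (psi (l * x) - psi x) * ln x - C * x
    <= isum (fun n => Lambda n * (psi (l * (x / n%:R)) - psi (x / n%:R))) 0 x ->
  psi (l * x) - psi x < eta * x ->
  isum (deficit l eta x) 0 x <= eta * (l + 1) * ln x + 8 * (2 * (l - 1) + eta * l) + C.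
Proof.
move=> l1 e0 x1; set I := isum _ 0 x => HI sparse.
have x0 : 0 < x := lt_le_trans ltr01 x1.
have termE : isum (deficit l eta x) 0 x = (2 * (l - 1) + eta * l) * mertens_real x - x^-1 * I.
  rewrite mertens_realE -!isumZ -isumB; apply: eq_big_nat => n /andP[n0 _].
  have {}n0 : 0 < n%:R :> R by rewrite ltr0n; case: n n0.
  by rewrite /deficit; field; rewrite !gt_eqF.
have lx0 : 0 <= ln x by rewrite ln_ge0.
have HI' : 2 * (l - 1) * ln x - eta * ln x - C <= x^-1 * I.
  rewrite [_^-1 * I]mulrC ler_pdivlMr //; apply: le_trans HI.
  have := ler_wpM2r lx0 (ltW sparse); clear; lra.
have /andP[_ mx] := mertens_real_bounds x1.
have cp : 0 <= 2 * (l - 1) + eta * l.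
  by rewrite addr_ge0 ?mulr_ge0 ?subr_ge0 ?(ltW l1) ?(ltW e0) // (ltW (lt_trans ltr01 l1)).
have := ler_wpM2l cp mx; rewrite termE; move: HI'; clear; lra.
Qed.

(** Where x/n < y0 a deficit may be negative, but Chebyshev's bound limits the density to 8 l, and
    the Mertens weight of this range is at most ln y0 + 10. *)
Lemma deficit_tail (l eta x y0 : R) : 1 < l -> 0 < eta -> 1 <= y0 -> y0 <= x ->
  - (8 * l) * (ln y0 + 10) <= isum (deficit l eta x) (x / y0) x.
Proof.
move=> l1 e0 y01 yx; have l0 : 0 < l := lt_trans ltr01 l1.
have y0p : 0 < y0 := lt_le_trans ltr01 y01; have x0 : 0 < x := lt_le_trans y0p yx.
have xy1 : 1 <= x / y0 by rewrite ler_pdivlMr // mul1r.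
have xyx : x / y0 <= x by rewrite ler_pdivrMr // ler_peMr // ltW.
have xy0 : 0 < x / y0 := lt_le_trans ltr01 xy1.
apply: le_trans (_ : - (8 * l) * (mertens_real x - mertens_real (x / y0)) <= _).
  have /andP[_] := mertens_realB_bounds xy1 xyx; rewrite ln_div ?posrE // subKr.
  by rewrite !mulNr lerN2; apply: ler_wpM2l; rewrite mulr_ge0 // ltW.
rewrite (mertens_realB (ltW xy0) xyx) -isumZ; apply: ler_isum => n /andP[nx _].
have n0 : 0 < n%:R :> R := lt_trans xy0 nx.
rewrite /deficit mulrC; apply: ler_wpM2l; first by rewrite divr_ge0 ?mangoldt_ge0.
have : 0 < x / n%:R by rewrite divr_gt0.
move: (x / n%:R) => y yp.
have : (psi (l * y) - psi y) / y <= 8 * l.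
  rewrite ler_pdivrMr // -mulrA lerBlDr; apply: le_trans (psi_linear _) _.
    by rewrite mulr_ge0 // ltW.
  by rewrite lerDl psi_ge0.
have : 0 <= eta * l := mulr_ge0 (ltW e0) (ltW l0).
by move: l1; clear; lra.
Qed.

(** The points x/n with n in (z, l' z] lie in [w, l' w). If all missed the extremal density by rho,
    the deficits would sum to at least rho times the Mertens weight of (z, l' z], which is at least
    d / l'. *)
Lemma extremal_point_in_window (l l' eta rho d beta z w x : R) : 0 < z -> 1 < l' -> 0 < rho ->
  0 < w -> l' * z = x / w -> z = x / (l' * w) -> beta = rho * d / l' ->
  d * z <= psi (l' * z) - psi z -> isum (deficit l eta x) z (l' * z) < beta ->
  exists2 y, w <= y < l' * w & (2 * (l - 1) + eta * l - rho) * y <= psi (l * y) - psi y.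
Proof.
move=> z0 l1' r0 w0 lzE zE bE dz small; apply: contrapT => none.
have l0' : 0 < l' := lt_trans ltr01 l1'; have lw0 : 0 < l' * w by rewrite mulr_gt0.
have x0 : 0 < x by move: z0; rewrite zE pmulr_lgt0 // invr_gt0.
have zlz : z <= l' * z by rewrite ler_peMl ?(ltW l1') ?(ltW z0).
have /andP[mp _] := mertens_realB_psi z0 zlz.
apply/negP: small; rewrite -leNgt.
apply: le_trans (_ : rho * (mertens_real (l' * z) - mertens_real z) <= _).
  rewrite bE -mulrA ler_wpM2l ?(ltW r0) //; apply: le_trans mp.
  rewrite ler_pdivlMr ?mulr_gt0 // mulrA divfK ?gt_eqF //.
rewrite mertens_realB ?(ltW z0) // -isumZ; apply: ler_isum => n /andP[zn nz].
have n0 : 0 < n%:R :> R := lt_trans z0 zn.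
rewrite /deficit mulrC; apply: ler_wpM2l; first by rewrite divr_ge0 ?mangoldt_ge0.
rewrite leNgt; apply/negP => dn; apply: none; exists (x / n%:R).
  apply/andP; split.
    by move: nz; rewrite lzE ler_pdivlMr // ler_pdivlMr // mulrC.
  by move: zn; rewrite zE ltr_pdivrMr // ltr_pdivrMr // mulrC.
have xn0 : 0 < x / n%:R by rewrite divr_gt0.
by move: dn; rewrite ltrBlDl -ltrBlDr ltr_pdivlMr // => /ltW.
Qed.

Lemma sparse_point_far (l eta B c : R) y0 : 0 < c -> 0 < eta -> ~ prime_dense l ->
  exists x, [/\ 1 <= x, y0 <= x, B < c * ln x & psi (l * x) - psi x < eta * x].
Proof.
move=> c0 e0 Hl; apply: contrapT => none; apply: Hl; exists eta => //.
exists (Num.max (Num.max 1 y0) (expR ((B + 1) / c))) => x.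
rewrite !ge_max => /andP[/andP[x1 yx] ex]; rewrite leNgt; apply/negP => sp.
apply: none; exists x; split=> //; rewrite mulrC -ltr_pdivrMr //.
apply: lt_le_trans (_ : (B + 1) / c <= _); first by rewrite ltr_pM2r ?invr_gt0 // ltrDl.
by rewrite -ler_expR lnK // posrE (lt_le_trans ltr01 x1).
Qed.

(** At a far sparse point x the deficits sum to little, so some block of n has a sum below beta, and
    [extremal_point_in_window] applies throughout that block. *)
Lemma extremal_points_on_block (l l' K rho eta0 : R) : 1 < l -> 1 < l' -> 1 < K -> 0 < rho -> 0 < eta0 ->
  prime_dense l' -> ~ prime_dense l ->
  exists eta w0, [/\ 0 < eta <= eta0, 1 <= w0,
    forall a b, 1 <= a -> a <= b -> w0 <= b -> psi b - psi a <= 2 * (b - a) + eta * b &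
    forall w, w0 <= w -> l' * w <= w0 * K -> exists2 y, w <= y < l' * w &
      (2 * (l - 1) + eta * l - rho) * y <= psi (l * y) - psi y].
Proof.
move=> l1 l1' K1 r0 e0 [d d0 [x1 Hd]] Hl.
have lK : 0 < ln K by rewrite ln_gt0.
have l0 : 0 < l := lt_trans ltr01 l1.
have l0' : 0 < l' := lt_trans ltr01 l1'.
have K0 : 0 < K := lt_trans ltr01 K1.
have Kp i : 0 < K ^+ i by exact: exprn_gt0.
pose beta := rho * d / l'.
have b0 : 0 < beta by rewrite divr_gt0 ?mulr_gt0.
have bK : 0 < beta / (2 * ln K) by apply: divr_gt0 => //; rewrite mulr_gt0.
(* This keeps the main term eta (l+1) ln x of the deficit sum below half of beta ln x / ln K, the
   amount allowed by [small_block]. *)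
pose eta := Num.min eta0 (beta / (2 * ln K) / (l + 1)).
have l10 : 0 < l + 1 by rewrite addr_gt0.
have eta_gt0 : 0 < eta by rewrite lt_min e0 divr_gt0.
have eta_le : eta <= eta0 by rewrite ge_min lexx.
have eta_le' : eta * (l + 1) <= beta / (2 * ln K).
  by rewrite -ler_pdivlMr // ge_min lexx orbT.
have [y0 y01 Hy] := psiB_upper eta_gt0.
have y0p : 0 < y0 := lt_le_trans ltr01 y01.
have [C HC] := selberg_ratio_lower (ltW l1).
have [j0 Hj0] := expr_unbounded x1 K1.
(* The errors independent of x; the other half exceeds them once x is far enough. *)
pose C2 := 8 * (2 * (l - 1) + eta * l) + C + 8 * l * (ln y0 + 10).
have [x [x_ge1 xy0 xB sparse]] :=
  @sparse_point_far l eta (C2 + beta * (ln y0 / ln K + 1 + j0%:R)) (beta / (2 * ln K)) y0 bK eta_gt0 Hl.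
have x0 : 0 < x := lt_le_trans ltr01 x_ge1.
have xy1 : 1 <= x / y0 by rewrite ler_pdivlMr // mul1r.
have xyx : x / y0 <= x by rewrite ler_pdivrMr // ler_peMr // ltW.
have term_ge0 n : 0 < (n%:R : R) <= x / y0 -> 0 <= deficit l eta x n := @deficit_ge0 l eta x y0 n l1 y01 Hy.
have small : isum (deficit l eta x) 0 (x / y0) < (ln (x / y0) / ln K - 1 - j0%:R) * beta.
  have tot := deficit_sum_upper l1 eta_gt0 x_ge1 (HC x x_ge1) sparse.
  have tail := deficit_tail l1 eta_gt0 y01 xy0.
  rewrite (isum_cat _ (le_trans ler01 xy1) xyx) in tot.
  have lx0 : 0 <= ln x by rewrite ln_ge0.
  have e2 := ler_wpM2r lx0 eta_le'.
  have e3 : beta / (2 * ln K) * ln x = ln x / ln K * beta / 2 by field; rewrite gt_eqF.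
  rewrite ln_div ?posrE // mulrBl; move: xB; rewrite e3; rewrite e3 in e2.
  by move: tot tail e2; rewrite /C2; clear; lra.
have [j [jj0 Kj blk]] := small_block K1 b0 xy1 term_ge0 small.
(* The points x/n with n in (K^j, K^(j+1)] fill the range [w0, K w0). *)
pose w0 := x / K ^+ j.+1.
have w0y : y0 <= w0 by move: Kj; rewrite /w0 ler_pdivlMr // ler_pdivlMr // mulrC.
exists eta, w0; split; first by rewrite eta_gt0.
- exact: le_trans w0y.
- by move=> a b a1 ab wb; apply: Hy => //; exact: le_trans wb.
move=> w w0w wK; have wp : 0 < w := lt_le_trans y0p (le_trans w0y w0w).
pose z := x / (l' * w).
have lw0 : 0 < l' * w by rewrite mulr_gt0.
have z0 : 0 < z by rewrite divr_gt0.
have lzE : l' * z = x / w by rewrite /z invfM mulrCA mulVKf ?gt_eqF.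
have zK : K ^+ j <= z.
  rewrite ler_pdivlMr // mulrC -ler_pdivlMr //; apply: le_trans wK _.
  by rewrite /w0 exprS invfM mulrA mulrAC divfK ?gt_eqF.
have lzK : l' * z <= K ^+ j.+1 by rewrite lzE ler_pdivrMr // mulrC -ler_pdivrMr.
have zlz : z <= l' * z by rewrite ler_peMl ?(ltW l1') ?(ltW z0).
have zx1 : x1 <= z.
  by apply: le_trans (le_trans Hj0 _) zK; rewrite ler_weXn2l ?(ltW K1).
apply: (extremal_point_in_window z0 l1' r0 wp lzE (erefl _) (erefl _) (Hd z zx1)).
apply: le_lt_trans blk.
have Kjz : 0 <= K ^+ j := ltW (Kp j).
rewrite (isum_cat _ zK (le_trans zlz lzK)) (isum_cat _ zlz lzK) addrCA lerDl.
have part u v : K ^+ j <= u -> v <= K ^+ j.+1 -> 0 <= isum (deficit l eta x) u v.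
  move=> ju vj; apply: isum_ge0 => n /andP[un nv]; apply: term_ge0.
  by rewrite (lt_trans (lt_le_trans (Kp j) ju) un) (le_trans nv (le_trans vj Kj)).
by rewrite addr_ge0 // part //; [exact: le_trans lzK | exact: le_trans zlz].
Qed.

(* For s close to 1 the thresholds s^m and s^(m+1) nearly agree, so that
   the intervals (y, s^m y] at extremal points y leave only gaps of ratio at most s. *)
Lemma prime_dense_step (s : R) m : 1 < s <= 11 / 10 -> (20 <= m)%N ->
  ~ prime_dense (s ^+ m) -> ~ prime_dense (s ^+ m.+1).
Proof.
move=> s12 m20 nd dense; have /andP[s1 s2] := s12.
have ms : 0 < m%:R * (s - 1) by apply: mulr_gt0; [rewrite ltr0n; lia | lra].
pose Q := (Num.truncn (20 / (m%:R * (s - 1)))).+1.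
have hQ : 20 <= Q%:R * (m%:R * (s - 1)).
  by rewrite -ler_pdivrMr //; apply: ltW; exact: truncnS_gt.
have sn n : (0 < n)%N -> 1 < s ^+ n by move=> n0; rewrite exprn_egt1 // -lt0n.
(* The block ratio has room for all (Q+1)m + 1 cells, and rho + eta <= (s-1)/20 + (s-1)/20 is the
   loss allowed for full cells. *)
have [||||||| eta [w0 [/andP[e0 e1] w1 Hup Hgood]]] :=
  @extremal_points_on_block (s ^+ m) (s ^+ m.+1) (s ^+ (Q.+1 * m).+1) ((s - 1) / 20) ((s - 1) / 20) => //.
- by apply: sn; lia.
- exact: sn.
- exact: sn.
- by lra.
- by lra.
apply: (@full_cells_contradiction R s eta ((s - 1) / 20) w0 m Q) => //; [lra|lra|lra|].
move=> i hi; have w0' : 0 <= w0 by lra.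
have [||y hy1 hy2] := Hgood (w0 * s ^+ i).
- by rewrite -[leLHS]mulr1 ler_wpM2l // exprn_ege1 // ltW.
- by rewrite mulrCA ler_wpM2l // -exprD ler_weXn2l; [|lra|lia].
exists y => //; move: hy1; rewrite mulrCA -exprD.
by rewrite (_ : (m.+1 + i = (i + m).+1)%N) //; lia.
Qed.

(** A failure at min(l, 2) = s^20, where s <= 11/10, would pass by [prime_dense_step] to every
    higher power of s, against [prime_dense_large]. *)
Lemma prime_dense_all (l : R) : 1 < l -> prime_dense l.
Proof.
move=> l1; pose l2 := Num.min l 2.
have l2_gt1 : 1 < l2 by rewrite /l2 lt_min l1; lra.
have l22 : l2 <= 2 by rewrite /l2 ge_min lexx orbT.
apply: (@prime_dense_le _ l2); first by rewrite /l2 ge_min lexx.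
apply: contrapT => nd.
pose s : R := expR (ln l2 / 20).
have s1 : 1 < s by rewrite /s expR_gt1 divr_gt0 ?ln_gt0.
have s20 : s ^+ 20 = l2.
  by rewrite /s -expRM_natr divfK ?pnatr_eq0 // lnK // posrE; lra.
have s2 : s <= 11 / 10.
  rewrite leNgt; apply/negP => h.
  have h4 : 14 / 10 <= s ^+ 4.
    have h2 : 121 / 100 <= s ^+ 2 by rewrite expr2; nra.
    by rewrite (exprM s 2 2) expr2; nra.
  have : 2 < s ^+ 20.
    apply: lt_le_trans (_ : s ^+ 12 <= _); last by apply: ler_weXn2l => //; lra.
    by rewrite (exprM s 4 3); move: (s ^+ 4) h4 => u hu; rewrite !exprS expr0; nra.
  by rewrite s20; lra.
have all_not j : ~ prime_dense (s ^+ (20 + j)).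
  elim: j => [|j IH]; first by rewrite addn0 s20.
  by rewrite addnS; apply: prime_dense_step IH; rewrite ?s1 ?s2 // leq_addr.
have [j hj] := expr_unbounded (expR 11) s1.
apply: (all_not j); apply: prime_dense_large; apply: le_trans hj _.
by apply: ler_weXn2l; [lra | rewrite leq_addl].
Qed.

End ErdosArgument.

(** * From prime powers to primes *)

Section ShortIntervals.
Variable R : realType.
Local Notation Lambda := (@mangoldt R).

(** A power q^a <= N of a prime q with a >= 2 has q <= r and a <= k, and each such pair contributes
    at most ln N. *)
Lemma sum_mangoldt_nonprime N r k : (N < r.+1 ^ 2)%N -> (N < 2 ^ k.+1)%N ->
  \sum_(1 <= n < N.+1 | ~~ prime n) Lambda n <= r.+1%:R * k.+1%:R * ln N%:R.
Proof.
move=> Nr Nk.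
have lN : 0 <= ln N%:R :> R := ln_nat_ge0 R N.
apply: le_trans (_ : \sum_(1 <= n < N.+1) \sum_(0 <= q < r.+1) \sum_(0 <= a < k.+1)
    ln N%:R * (n == (q ^ a)%N)%:R <= _).
  rewrite big_mkcond; apply: ler_sum_nat => n /andP[n0 nN].
  have nonneg : 0 <= \sum_(0 <= q < r.+1) \sum_(0 <= a < k.+1) ln N%:R * (n == (q ^ a)%N)%:R :> R.
    by apply: sumr_ge0 => q _; apply: sumr_ge0 => a _; rewrite mulr_ge0.
  case: ifPn => // npn; have [->//|] := eqVneq (Lambda n) 0.
  move=> /(mangoldt_neq0 n0)[q [a [pq a0 nE]]].
  have a2 : (1 < a)%N.
    by case: a a0 nE npn => // -[_ ->|//]; rewrite expn1 pq.
  have q1 := prime_gt1 pq.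
  have qr : (q < r.+1)%N.
    rewrite -(@ltn_exp2r _ _ 2) //; apply: leq_ltn_trans Nr; rewrite -ltnS.
    apply: leq_ltn_trans nN; rewrite nE leq_exp2l //.
  have ak : (a < k.+1)%N.
    rewrite -(@ltn_exp2l 2) //; apply: leq_ltn_trans Nk; rewrite -ltnS.
    by apply: leq_ltn_trans nN; rewrite nE leq_exp2r.
  rewrite (bigD1_seq q) ?mem_index_iota ?iota_uniq //=.
  rewrite (bigD1_seq a) ?mem_index_iota ?iota_uniq //=.
  rewrite -nE eqxx mulr1 -addrA; apply: le_trans (_ : ln N%:R <= _).
    have N0 : (0 < N)%N by apply: leq_trans n0 _; rewrite -ltnS.
    by apply: le_trans (mangoldt_le R n) _; rewrite ler_ln ?posrE ?ltr0n // ler_nat -ltnS.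
  rewrite lerDl addr_ge0 //; last apply: sumr_ge0 => ? _; apply: sumr_ge0 => ? _; exact: mulr_ge0.
rewrite exchange_big_nat /=.
have inner q a : \sum_(1 <= n < N.+1) ln N%:R * (n == (q ^ a)%N)%:R <= ln N%:R :> R.
  by rewrite -mulr_sumr -[leRHS]mulr1 ler_wpM2l // sum_indicator_le1.
apply: le_trans (_ : \sum_(0 <= q < r.+1) \sum_(0 <= a < k.+1) ln N%:R <= _).
  by apply: ler_sum_nat => q _; rewrite exchange_big_nat; apply: ler_sum_nat => a _; exact: inner.
by rewrite !sumr_const_nat !subn0 -mulrnA mulnC -natrM mulr_natl.
Qed.

(** Take r near sqrt N and k near log N; the logarithms are absorbed by N^(1/4), giving
    O(N^(3/4)). *)
Lemma sum_mangoldt_nonprime_le N : (0 < N)%N ->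
  \sum_(1 <= n < N.+1 | ~~ prime n) Lambda n <= 448 * Num.sqrt (Num.sqrt N%:R) ^+ 3.
Proof.
move=> N0; set s := Num.sqrt N%:R : R; set v := Num.sqrt s.
have NR : 1 <= N%:R :> R by rewrite ler1n.
have s2 : s ^+ 2 = N%:R by rewrite sqr_sqrtr.
have s1 : 1 <= s by rewrite -(@ler_pXn2r _ 2) ?nnegrE ?sqrtr_ge0 // expr1n s2.
have v2 : v ^+ 2 = s by rewrite sqr_sqrtr //; lra.
have v0 : 0 <= v by exact: sqrtr_ge0.
pose r := Num.truncn s; pose k := trunc_log 2 N.
have /andP[rs sr] : r%:R <= s < r.+1%:R by apply: truncn_itv; lra.
have Nr : (N < r.+1 ^ 2)%N.
  by rewrite -(ltr_nat R) natrX -s2 ltr_pXn2r ?nnegrE //; lra.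
have /andP[kN Nk] : (2 ^ k <= N < 2 ^ k.+1)%N by exact: trunc_log_bounds.
apply: le_trans (sum_mangoldt_nonprime Nr Nk) _.
have lN : ln N%:R = 2 * ln s by rewrite -s2 lnXn ?mulr_natl //; lra.
have kl : k%:R <= 2 * ln N%:R :> R.
  have l2 : 1 / 2 <= ln (2 : R) by apply: le_trans (ln_ge_subrV _) => //; lra.
  have : ln ((2 ^ k)%N%:R : R) <= ln N%:R.
    by rewrite ler_ln ?posrE ?ltr0n ?expn_gt0 // ler_nat.
  rewrite natrX lnXn // -[ln 2 *+ k]mulr_natl; have : 0 <= k%:R :> R by []; nra.
have ls0 : 0 <= ln s by rewrite ln_ge0.
have := ln_sqr_le_sqrt s1; rewrite -/v => hv.
rewrite -2!natr1 lN; rewrite lN in kl.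
have h1 : (r%:R + 1) * (k%:R + 1) <= 2 * s * (4 * ln s + 1).
  by apply: ler_pM; rewrite ?addr_ge0 //; lra.
apply: le_trans (_ : 2 * s * (4 * ln s + 1) * (2 * ln s) <= _).
  by apply: ler_wpM2r => //; lra.
have h2 : (4 * ln s + 1) * (2 * ln s) <= 224 * v by nra.
have : 2 * s * ((4 * ln s + 1) * (2 * ln s)) <= 2 * s * (224 * v) by apply: ler_wpM2l => //; lra.
rewrite (exprS v 2) v2; lra.
Qed.

Lemma prime_in_short_interval (l : R) : 1 < l -> exists x0 : R, forall x, x0 <= x ->
  exists2 p, prime p & x < p%:R <= l * x.
Proof.
move=> l1; have [d d0 [x1 Hd]] := prime_dense_all l1.
have l0 : 0 < l by lra.
(* Without a prime, d x <= 448 v^3 with v^4 = N <= l x, which forces v <= v0 and bounds x. *)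
pose v0 := 448 * l / d.
have v00 : 0 < v0 by rewrite /v0 divr_gt0 //; lra.
exists (Num.max x1 (v0 ^+ 4 + 1)) => x; rewrite ge_max => /andP[xx1 xv].
apply: contrapT => none.
have v04 : 0 < v0 ^+ 4 by rewrite exprn_gt0.
have x0 : 1 <= x by lra.
have lx : x <= l * x by rewrite ler_peMl; lra.
have lx0 : 0 <= l * x by lra.
pose N := Num.truncn (l * x).
have N0 : (0 < N)%N by rewrite truncn_gt0; lra.
have /andP[N1 N2] := truncn_itv lx0; rewrite -/N in N1 N2.
have : d * x <= 448 * Num.sqrt (Num.sqrt N%:R) ^+ 3.
  apply: le_trans (Hd x xx1) _; rewrite psiB //; last by lra.
  apply: le_trans (sum_mangoldt_nonprime_le N0); rewrite [leRHS]big_mkcond /=.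
  rewrite [leRHS](@big_cat_nat _ _ _ (Num.truncn x).+1) //=; last by rewrite ltnS le_truncn.
  apply: ler_wpDl.
    by apply: sumr_ge0 => n _; case: ifP => // _; exact: mangoldt_ge0.
  apply: ler_sum_nat => n hn; case: ifPn => //; rewrite negbK => pn.
  by case: none; exists n => //; exact: mem_isum.
set v := Num.sqrt (Num.sqrt N%:R) => hv.
have vv : v ^+ 4 = N%:R by rewrite (exprM v 2 2) !sqr_sqrtr ?sqrtr_ge0.
have vp : 0 < v by rewrite !sqrtr_gt0 ltr0n.
have vle : v <= v0.
  rewrite /v0 ler_pdivlMr // -(@ler_pM2r _ (v ^+ 3)) ?exprn_gt0 //.
  apply: le_trans (_ : d * (l * x) <= _).
    rewrite mulrAC -(exprS v 3) vv mulrC; apply: ler_wpM2l => //; lra.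
  have : l * (d * x) <= l * (448 * v ^+ 3) by apply: ler_wpM2l => //; lra.
  lra.
have : v ^+ 4 <= v0 ^+ 4 by rewrite ler_pXn2r ?nnegrE //; lra.
rewrite vv; rewrite -natr1 in N2; lra.
Qed.

End ShortIntervals.

(** * Sets with a forbidden distance *)

Section LowDegree.
Variables (F : comNzRingType) (n : nat).
Implicit Types (f g : {set 'I_n} -> F) (S T B : {set 'I_n}).

(** These are the multilinear polynomials of degree at most k on the cube: the monomial of S takes
    the value 1 at B when S is contained in B. *)
Definition lowdeg k f := exists c : {set 'I_n} -> F,
  forall B, f B = \sum_(S : {set 'I_n} | (#|S| <= k)%N) c S * (S \subset B)%:R.

Lemma lowdeg_monomial k T : (#|T| <= k)%N -> lowdeg k (fun B => (T \subset B)%:R).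
Proof.
move=> Tk; exists (fun S => (S == T)%:R) => B.
rewrite (bigD1 T) //= eqxx mul1r big1 ?addr0 // => S /andP[_ /negbTE->].
by rewrite mul0r.
Qed.

Lemma lowdegD k f g : lowdeg k f -> lowdeg k g -> lowdeg k (fun B => f B + g B).
Proof.
move=> [c cE] [d dE]; exists (fun S => c S + d S) => B.
by rewrite cE dE -big_split /=; apply: eq_bigr => S _; rewrite mulrDl.
Qed.

Lemma lowdegZ k a f : lowdeg k f -> lowdeg k (fun B => a * f B).
Proof.
move=> [c cE]; exists (fun S => a * c S) => B.
by rewrite cE mulr_sumr; apply: eq_bigr => S _; rewrite mulrA.
Qed.

Lemma lowdeg_sum k (I : finType) (P : pred I) (f : I -> {set 'I_n} -> F) :
  (forall i, P i -> lowdeg k (f i)) -> lowdeg k (fun B => \sum_(i | P i) f i B).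
Proof.
move=> Hf; have /choice[c cE] : forall i, exists d : {set 'I_n} -> F, P i -> forall B,
    f i B = \sum_(S : {set 'I_n} | (#|S| <= k)%N) d S * (S \subset B)%:R.
  move=> i; case: (boolP (P i)) => Pi; last by exists (fun=> 0).
  by have [d dE] := Hf i Pi; exists d.
exists (fun S => \sum_(i | P i) c i S) => B.
transitivity (\sum_(i | P i) \sum_(S : {set 'I_n} | (#|S| <= k)%N) c i S * (S \subset B)%:R).
  by apply: eq_bigr => i Pi; exact: cE.
by rewrite exchange_big /=; apply: eq_bigr => S _; rewrite mulr_suml.
Qed.

Lemma lowdegW k l f : (k <= l)%N -> lowdeg k f -> lowdeg l f.
Proof.
move=> kl [c cE]; suff [d dE] : lowdeg l (fun B => \sum_(S : {set 'I_n} | (#|S| <= k)%N) c S * (S \subset B)%:R).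
  by exists d => B; rewrite cE dE.
apply: lowdeg_sum => S Sk; apply: lowdegZ; apply: lowdeg_monomial; exact: leq_trans kl.
Qed.

(** Multilinear reduction: on 0/1 values x_i^2 = x_i, so the monomial of S becomes that of
    [i |: S]. *)
Lemma lowdeg_mem k f i : lowdeg k f -> lowdeg k.+1 (fun B => f B * (i \in B)%:R).
Proof.
move=> [c cE].
suff [d dE] : lowdeg k.+1 (fun B => \sum_(S : {set 'I_n} | (#|S| <= k)%N) c S * (i |: S \subset B)%:R).
  exists d => B; rewrite -dE cE mulr_suml; apply: eq_bigr => S _.
  by rewrite -mulrA -natrM mulnb finset.subUset finset.sub1set andbC.
apply: lowdeg_sum => S Sk; apply: lowdegZ; apply: lowdeg_monomial.
by rewrite cardsU1; case: (i \in S) => /=; rewrite ?add0n ?add1n // ltnW.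
Qed.

Lemma lowdeg_affine k f (a : F) (b : 'I_n -> F) : lowdeg k f ->
  lowdeg k.+1 (fun B => f B * (a + \sum_i b i * (i \in B)%:R)).
Proof.
move=> Hf.
suff [d dE] : lowdeg k.+1 (fun B => a * f B + \sum_i b i * (f B * (i \in B)%:R)).
  exists d => B; rewrite -dE mulrDr mulrC mulr_sumr; congr (_ + _).
  by apply: eq_bigr => i _; rewrite mulrCA.
apply: lowdegD; first by apply: lowdegZ; exact: lowdegW Hf.
by apply: lowdeg_sum => i _; apply: lowdegZ; exact: lowdeg_mem.
Qed.

Lemma lowdeg_prod_affine (I : Type) (s : seq I) (a : I -> F) (b : I -> 'I_n -> F) :
  lowdeg (size s) (fun B => \prod_(j <- s) (a j + \sum_i b j i * (i \in B)%:R)).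
Proof.
elim: s => [|j s IH].
  have [d dE] := @lowdeg_monomial 0 finset.set0 (eq_leq (finset.cards0 _)).
  by exists d => B; rewrite big_nil -dE finset.sub0set.
have [d dE] := lowdeg_affine (a j) (b j) IH.
by exists d => B; rewrite big_cons mulrC dE.
Qed.

End LowDegree.

(** The matrix of the values f_i(v_j) is diagonal and invertible, and it factors through the
    coefficients, so its rank is at most the number of monomials. *)
Lemma lowdeg_family_card (F : fieldType) n k (I : finType) (v : I -> {set 'I_n})
    (f : I -> {set 'I_n} -> F) :
  (forall i, lowdeg k (f i)) -> (forall i j, (f i (v j) != 0) = (i == j)) ->
  (#|I| <= #|[set S : {set 'I_n} | (#|S| <= k)%N]|)%N.
Proof.
move=> /choice[c cE] fv; set D := [set S | _].
pose M := \matrix_(i < #|I|, j < #|I|) f (enum_val i) (v (enum_val j)).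
pose C := \matrix_(i < #|I|, s < #|D|) c (enum_val i) (enum_val s).
pose E : 'M[F]_(#|D|, #|I|) := \matrix_(s < #|D|, j < #|I|) ((enum_val s : {set 'I_n}) \subset v (enum_val j))%:R.
have ME : M = C *m E.
  apply/matrixP => i j; rewrite !mxE cE.
  transitivity (\sum_(S in D) c (enum_val i) S * (S \subset v (enum_val j))%:R).
    by apply: eq_bigl => S; rewrite finset.inE.
  by rewrite big_enum_val; apply: eq_bigr => S _; rewrite !mxE.
have Mu : M \in unitmx.
  have -> : M = diag_mx (\row_i M i i).
    apply/matrixP => i j; rewrite !mxE; have [->|ij] := eqVneq i j; first by rewrite mulr1n.
    rewrite mulr0n; apply/eqP; rewrite -[_ == 0]negbK fv (inj_eq enum_val_inj) //.
  rewrite unitmxE det_diag unitfE; apply/prodf_neq0 => i _.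
  by rewrite !mxE fv.
by rewrite -[leqLHS](mxrank_unit Mu) ME mulmx_max_rank.
Qed.

Lemma card_small_sets n k :
  (#|[set S : {set 'I_n} | (#|S| < k)%N]| = \sum_(i < k) 'C(n, i))%N.
Proof.
elim: k => [|k IH].
  by rewrite big_ord0; apply/eqP; rewrite cards_eq0; apply/eqP/finset.setP => S; rewrite !finset.inE.
rewrite big_ord_recr /= -IH.
rewrite -[X in 'C(X, _)](card_ord n) -card_draws -cardsUI.
have -> : [set S : {set 'I_n} | (#|S| < k)%N] :&: [set A : {set 'I_n} | #|A| == k] = finset.set0.
  by apply/finset.setP => S; rewrite !finset.inE; case: ltngtP.
rewrite finset.cards0 addn0; apply: eq_card => S.
by rewrite !finset.inE ltnS leq_eqVlt orbC.
Qed.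

Definition set_dist (n : nat) (A B : {set 'I_n}) : nat :=
  (\sum_(i < n) ((i \in A) != (i \in B)))%N.

Lemma set_dist_eq0 n (A B : {set 'I_n}) : (set_dist A B == 0)%N = (A == B).
Proof.
rewrite /set_dist sum_nat_eq0; apply/forallP/eqP => [h|-> i]; last by rewrite eqxx.
by apply/finset.setP => i; have := h i; rewrite /= eqb0 negbK => /eqP.
Qed.

Lemma set_dist_le n (A B : {set 'I_n}) : (set_dist A B <= n)%N.
Proof.
rewrite /set_dist -[leqRHS]card_ord -sum1_card; apply: leq_sum => i _.
by case: (_ != _).
Qed.

Lemma set_distE n (A B : {set 'I_n}) :
  (set_dist A B + 2 * \sum_(i < n) (i \in A) * (i \in B) = #|A| + #|B|)%N.
Proof.
rewrite /set_dist -!sum1_card [in RHS]big_mkcond [X in _ = (_ + X)%N]big_mkcond big_distrr /=.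
rewrite -!big_split /=; apply: eq_bigr => i _.
by case: (i \in A); case: (i \in B).
Qed.

(** For bits a, b one has (a - b)^2 = a + (1 - 2a) b, so the distance to a fixed A is affine in the
    coordinates of B. *)
Lemma set_dist_ring (F : comNzRingType) n (A B : {set 'I_n}) :
  (set_dist A B)%:R = #|A|%:R + \sum_i (1 - 2 * (i \in A)%:R) * (i \in B)%:R :> F.
Proof.
have -> : #|A| = (\sum_(i < n) (i \in A))%N.
  by rewrite -sum1_card big_mkcond; apply: eq_bigr => i _; case: (i \in A).
rewrite /set_dist !natr_sum -big_split /=; apply: eq_bigr => i _.
by case: (i \in A); case: (i \in B) => /=; ring.
Qed.

(* As p is odd and distances are even and less than 4p, only the distances 0 and
   2p are divisible by p. *)
Lemma forbidden_distance_card n p (Fam : {set {set 'I_n}}) :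
  prime p -> odd p -> (n < 4 * p)%N ->
  (forall A, A \in Fam -> ~~ odd #|A|) ->
  (forall A B, A \in Fam -> B \in Fam -> set_dist A B <> (2 * p)%N) ->
  (#|Fam| <= \sum_(i < p) 'C(n, i))%N.
Proof.
move=> pp oddp n4p Heven Hdist; have p0 := prime_gt0 pp.
pose I := {A : {set 'I_n} | A \in Fam}.
have -> : #|Fam| = #|{: I}| by rewrite card_sig.
have F0 m : (m%:R == 0 :> 'F_p) = (p %| m)%N by rewrite (dvdn_pcharf (pchar_Fp pp)).
pose f (A : I) (B : {set 'I_n}) : 'F_p :=
  \prod_(r <- index_iota 1 p) ((#|val A|%:R - r%:R) + \sum_i (1 - 2 * (i \in val A)%:R) * (i \in B)%:R).
have fE A B : f A B = \prod_(r <- index_iota 1 p) ((set_dist (val A) B)%:R - r%:R).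
  by apply: eq_bigr => r _; rewrite set_dist_ring addrAC.
rewrite -card_small_sets.
have -> : [set S : {set 'I_n} | (#|S| < p)%N] = [set S : {set 'I_n} | (#|S| <= p.-1)%N].
  by apply/finset.setP => S; rewrite !finset.inE -{1}(prednK p0) ltnS.
apply: (@lowdeg_family_card 'F_p n p.-1 I val f) => [A|A B].
  have := @lowdeg_prod_affine 'F_p n nat (index_iota 1 p) (fun r => #|val A|%:R - r%:R)
    (fun r i => 1 - 2 * (i \in val A)%:R).
  by rewrite size_iota subn1.
rewrite fE prodf_seq_neq0; set w := set_dist _ _.
apply/allP/eqP => [h|AB r].
  have pw : (p %| w)%N.
    apply: contraT => npw; have r0 : (0 < w %% p)%N by rewrite lt0n.
    have := h (w %% p)%N; rewrite mem_index_iota r0 ltn_mod p0 => /(_ isT) /=.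
    have -> : w%:R = (w %% p)%:R :> 'F_p.
      by rewrite [in LHS](divn_eq w p) natrD natrM; have /eqP-> : p%:R == 0 :> 'F_p; rewrite ?F0 // mulr0 add0r.
    by rewrite subrr eqxx.
  have ew : ~~ odd w.
    have := set_distE (val A) (val B); rewrite -/w.
    move: (Heven _ (valP A)) (Heven _ (valP B)); move: #|val A| #|val B| => a b.
    by clear; move: (\sum_(i < n) _)%N => c; lia.
  apply/val_inj/eqP; rewrite -set_dist_eq0 -/w; apply: contraT => w0.
  have := Hdist _ _ (valP A) (valP B); rewrite -/w => wp.
  have wn : (w <= n)%N := set_dist_le _ _.
  case/dvdnP: pw => q wE; rewrite wE oddM oddp andbT in ew.
  have q4 : (q < 4)%N by rewrite -(ltn_pmul2r p0) -wE; exact: leq_ltn_trans wn n4p.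
  move: q q4 ew wE => [|[|[|[|]]]] //= _ _ wE; first by rewrite wE in w0.
rewrite mem_index_iota => /andP[r0 rp] /=.
have -> : w = 0%N by apply/eqP; rewrite set_dist_eq0 AB.
by rewrite sub0r oppr_eq0 F0 gtnNdvd.
Qed.

(** Toggling the element [ord0] is an involution that exchanges even and odd sets. *)
Lemma card_even_sets n : (0 < n)%N ->
  (#|[set A : {set 'I_n} | ~~ odd #|A|]| * 2 = 2 ^ n)%N.
Proof.
case: n => // n _; set E := [set A | _].
pose t (A : {set 'I_n.+1}) := if ord0 \in A then A :\ ord0 else ord0 |: A.
have tK : involutive t.
  move=> A; rewrite /t; case h: (ord0 \in A); rewrite !finset.inE eqxx /=; first by rewrite finset.setD1K.
  by rewrite finset.setU1K // h.
have todd A : odd #|t A| = ~~ odd #|A|.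
  rewrite /t; case: ifP => h; last by rewrite cardsU1 h.
  by rewrite [in RHS](cardsD1 ord0) h /= negbK.
have Et : ~: E = t @: E.
  apply/finset.setP => A; rewrite !finset.inE negbK; apply/idP/imsetP => [oA|[B]].
    by exists (t A); rewrite ?finset.inE ?todd ?oA ?tK.
  by rewrite finset.inE => eB ->; rewrite todd.
rewrite muln2 -addnn -{2}(card_imset (mem E) (inv_inj tK)) -Et cardsC.
by rewrite -cardsT -powersetT card_powerset cardsT card_ord.
Qed.

Lemma coloring_lower_bound (n p m : nat) (f : {set 'I_n} -> nat) : (0 < n)%N ->
  prime p -> odd p -> (n < 4 * p)%N ->
  (forall A : {set 'I_n}, ~~ odd #|A| -> (f A < m)%N) ->
  (forall A B : {set 'I_n}, ~~ odd #|A| -> ~~ odd #|B| -> set_dist A B = (2 * p)%N -> f A <> f B) ->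
  (2 ^ n <= 2 * (m * \sum_(i < p) 'C(n, i)))%N.
Proof.
move=> n0 pp oddp n4p fm fd; rewrite -card_even_sets // mulnC leq_mul2l /=.
set E := [set A | _].
(* Each colour class avoids the distance 2p. The type of colours must be inhabited, so m = 0, where
   no even set could be coloured, is treated apart. *)
rewrite -sum1_card (partition_big (fun A => inord (f A) : 'I_m.-1.+1) xpredT) //=.
have [m0|m0] := posnP m.
  rewrite m0 mul0n big1 // => c _; rewrite big1 // => A /andP[AE _].
  by move: AE; rewrite finset.inE => /fm; rewrite m0.
apply: (@leq_trans (\sum_(c < m.-1.+1) \sum_(i < p) 'C(n, i))%N); last first.
  by rewrite sum_nat_const card_ord prednK.
apply: leq_sum => c _.
rewrite sum1dep_card -/(mem _).
apply: (@forbidden_distance_card n p) => // [A|A B]; rewrite !finset.inE; first by case/andP.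
move=> /andP[eA /eqP cA] /andP[eB /eqP cB] /(fd _ _ eA eB); apply.
by have := congr1 val (etrans cA (esym cB)); rewrite /= !inordK // ?prednK ?fm.
Qed.

(** * The distance graph *)

(** The changes of a bit along a walk telescope modulo 2; on a closed walk their number is even. *)
Lemma odd_changes (T : Type) (f : T -> bool) x s :
  odd (sumn (pairmap (fun a b => (f a != f b) : nat) x s)) = (f x != f (last x s)).
Proof.
elim: s x => [|y s IH] x /=; first by rewrite eqxx.
by rewrite oddD IH; case: (f x); case: (f y); case: (f (last y s)).
Qed.

Lemma sumn_changes_le (T : Type) (f : T -> bool) x s :
  (sumn (pairmap (fun a b => (f a != f b) : nat) x s) <= size s)%N.
Proof. by elim: s x => [|y s IH] x //=; have := IH y; case: (_ != _) => /=; lia. Qed.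

Lemma sumn_pairmap_sum (T : Type) n (g : 'I_n -> T -> T -> nat) x s :
  (\sum_(i < n) sumn (pairmap (g i) x s)
   = sumn (pairmap (fun a b => \sum_(i < n) g i a b) x s))%N.
Proof.
elim: s x => [|y s IH] x /=; first by rewrite big1.
by rewrite big_split /= IH.
Qed.

Lemma sumn_pairmap_path (T : Type) (e : rel T) (g : T -> T -> nat) d x s :
  (forall a b, e a b -> g a b = d) -> path e x s -> sumn (pairmap g x s) = (size s * d)%N.
Proof.
move=> eg; elim: s x => [//|y s IH] x /= /andP[exy pys].
by rewrite (eg _ _ exy) IH // mulSn.
Qed.

Section CubeGraph.
Variable R : realType.
Implicit Types n p : nat.

Definition indicator n (A : {set 'I_n}) : 'rV[R]_n := \row_i (i \in A)%:R.

Definition support n (x : 'rV[R]_n) : {set 'I_n} := [set i | x ord0 i == 1]%SET.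

Lemma indicatorK n : cancel (@indicator n) (@support n).
Proof.
by move=> A; apply/finset.setP => i; rewrite finset.inE mxE; case: (i \in A); rewrite ?eqxx // eq_sym oner_eq0.
Qed.

Definition cube_edges n p : set (set 'rV[R]_n) :=
  [set e | exists A B : {set 'I_n}, [/\ ~~ odd #|A|, ~~ odd #|B|,
     set_dist A B = (2 * p)%N & e = [set indicator A; indicator B]]]%classic.

Definition cube_vertices n : set 'rV[R]_n :=
  [set x | exists2 A : {set 'I_n}, ~~ odd #|A| & x = indicator A]%classic.

Lemma cube_edgesP n p : (0 < p)%N -> forall e, @cube_edges n p e ->
  exists x y, [/\ @cube_vertices n x, @cube_vertices n y, x <> y & e = [set x; y]%classic].
Proof.
move=> p0 e [A [B [eA eB AB ->]]]; exists (indicator A), (indicator B); split=> //.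
- by exists A.
- by exists B.
move=> /(can_inj (@indicatorK n)) E; move: AB; rewrite E => /eqP.
have /eqP -> : set_dist B B == 0%N by rewrite set_dist_eq0.
by rewrite eq_sym muln_eq0 /= gtn_eqF.
Qed.

Definition cube_graph n p (p0 : (0 < p)%N) : sgraph 'rV[R]_n := SGraph (@cube_edgesP n p p0).

Lemma set2_eq (T : Type) (x y a b : T) : [set x; y]%classic = [set a; b]%classic ->
  (x = a /\ y = b) \/ (x = b /\ y = a).
Proof.
move=> E.
have : [set a; b]%classic x by rewrite -E; left.
have : [set a; b]%classic y by rewrite -E; right.
have : [set x; y]%classic a by rewrite E; left.
have : [set x; y]%classic b by rewrite E; right.
by move=> /= [] ? [] ? [] ? [] ?; subst; (left + right).
Qed.

Lemma set_distC n (A B : {set 'I_n}) : set_dist A B = set_dist B A.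
Proof. by rewrite /set_dist; apply: eq_bigr => i _; rewrite eq_sym. Qed.

Lemma cube_adjacent n p (p0 : (0 < p)%N) x y :
  Defs.adjacent (@cube_graph n p p0) x y ->
  set_dist (support x) (support y) = (2 * p)%N.
Proof.
rewrite /Defs.adjacent /= => -[A [B [_ _ AB E]]].
by have [[-> ->]|[-> ->]] := set2_eq E; rewrite !indicatorK // set_distC.
Qed.

Lemma cube_distance_graph n p (p0 : (0 < p)%N) : is_distance_graph (@cube_graph n p p0).
Proof.
exists (Num.sqrt (2 * p)%:R); first by rewrite sqrtr_gt0 ltr0n muln_gt0.
move=> _ [A [B [eA eB AB ->]]]; exists (indicator A), (indicator B); split=> //.
- by exists A.
- by exists B.
rewrite /euclidean_norm -AB /set_dist natr_sum; congr Num.sqrt; apply: eq_bigr => i _.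
by rewrite !mxE; case: (i \in A); case: (i \in B) => /=; ring.
Qed.

Lemma cube_odd_cycle n p (p0 : (0 < p)%N) c : is_odd_cycle (@cube_graph n p p0) c ->
  (size c * (2 * p) <= n * (size c).-1)%N.
Proof.
case; rewrite /ucycle; case: c => [|x s] //= /andP[cyc _] _ oddc.
set e := fun _ _ => _ in cyc.
have ed a b : e a b -> (\sum_(i < n) ((i \in support a) != (i \in support b)) = 2 * p)%N.
  by move=> /asboolP; exact: cube_adjacent.
have := sumn_pairmap_path ed cyc; rewrite size_rcons => <-.
rewrite -sumn_pairmap_sum -[X in (_ <= X * _)%N]card_ord -sum_nat_const; apply: leq_sum => i _.
have := odd_changes (fun a => i \in support a) x (rcons s x).
have := sumn_changes_le (fun a => i \in support a) x (rcons s x).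
rewrite last_rcons eqxx size_rcons; set N := sumn _ => N1 N2.
(* N is even and the cycle length [(size s).+1] is odd. *)
by have : N != (size s).+1; [apply: contraFneq N2 => -> | lia].
Qed.

(** As (L - 1)/L increases with L, a cycle of odd length L <= 2k+1 would give 2p (2k+1) <= 2k n by
    [cube_odd_cycle]. *)
Lemma cube_odd_girth n p (p0 : (0 < p)%N) k : (2 * k * n < (2 * k + 1) * (2 * p))%N ->
  (((2 * k + 1)%N%:~R)%:E < odd_girth R (@cube_graph n p p0))%E.
Proof.
move=> kn; apply: (@lt_le_trans _ _ ((2 * k + 2)%N%:R)%:E).
  by rewrite lte_fin -pmulrn ltr_nat ltn_add2l.
apply/ereal_infP => _ [c cyc <-]; rewrite lee_fin ler_nat.
have c3 : (2 < size c)%N by case: cyc.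
have := cube_odd_cycle cyc; case: (size c) c3 => // L _ /= h.
by rewrite leqNgt; apply/negP => Lk; nia.
Qed.

Lemma cube_chromatic n p (p0 : (0 < p)%N) (z : R) : (0 < n)%N -> prime p -> odd p ->
  (n < 4 * p)%N -> z ^+ n * (2 * (\sum_(i < p) 'C(n, i))%N%:R) <= 2 ^+ n ->
  ((z ^+ n)%:E <= chromatic_number R (@cube_graph n p p0))%E.
Proof.
move=> n0 pp oddp n4p hz; apply/ereal_infP => _ [m [f [fm fd]] <-]; rewrite lee_fin.
have h : (2 ^ n <= 2 * (m * \sum_(i < p) 'C(n, i)))%N.
  apply: (@coloring_lower_bound n p m (fun A => f (indicator A))) => // [A eA|A B eA eB AB].
    by apply: fm; exists A.
  by apply: fd; exists A, B.
move: h; set S := (\sum_(i < p) 'C(n, i))%N in hz *.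
have S0 : (0 < S)%N by rewrite /S (bigD1 (Ordinal p0)) //= bin0.
rewrite -(ler_nat R) natrX !natrM => h.
have S0' : 0 < S%:R :> R by rewrite ltr0n.
have S2 : 0 < 2 * S%:R :> R by rewrite mulr_gt0.
rewrite -(ler_pM2r S2); apply: le_trans hz (le_trans h _).
by rewrite mulrCA.
Qed.

Lemma chromatic_number_ge0 T (G : sgraph T) : (0 <= chromatic_number R G)%E.
Proof. by apply/ereal_infP => _ [m _ <-]; rewrite lee_fin. Qed.

(** Chernoff's method: t^p <= t^i for i < p, and the weighted sum is part of the expansion of (1 +
    t)^n. *)
Lemma binomial_tail (t : R) n p : 0 < t <= 1 ->
  t ^+ p * (\sum_(i < p) 'C(n, i))%N%:R <= (1 + t) ^+ n.
Proof.
move=> /andP[t0 t1]; rewrite exprDn natr_sum mulr_sumr.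
have le1 i : (i < p)%N -> t ^+ p * 'C(n, i)%:R <= 'C(n, i)%:R * t ^+ i.
  by move=> ip; rewrite mulrC ler_wpM2l // ler_wiXn2l // ?(ltW t0) // ltnW.
apply: le_trans (_ : \sum_(i < p) 'C(n, i)%:R * t ^+ i <= _).
  by apply: ler_sum => i _; exact: le1.
rewrite -(big_mkord xpredT (fun i => 'C(n, i)%:R * t ^+ i)).
rewrite (eq_bigr (fun i : 'I_n.+1 => 'C(n, i)%:R * t ^+ i)); last first.
  by move=> i _; rewrite expr1n mul1r mulr_natl.
rewrite -(big_mkord xpredT (fun i => 'C(n, i)%:R * t ^+ i)).
have nonneg i : 0 <= 'C(n, i)%:R * t ^+ i by rewrite mulr_ge0 // exprn_ge0 // ltW.
have [pn|np] := leqP p n.+1.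
  by rewrite [leRHS](@big_cat_nat _ _ _ p) //= lerDl sumr_ge0.
rewrite (@big_cat_nat _ _ _ n.+1) /= ?(ltnW np) // [X in _ + X]big1_seq ?addr0 //.
by move=> i; rewrite mem_index_iota => /andP[_ /andP[ni _]]; rewrite bin_small // mul0r.
Qed.

Lemma cube_parameters k (z : R) : (0 < k)%N -> 0 < z ->
  let a : R := k%:R / (2 * k%:R + 1) in
  let b : R := (k%:R + 1) / (2 * k%:R + 1) in
  ln z < ln 2 + a * ln a + b * ln b ->
  exists n0, forall n, (n0 <= n)%N -> exists p,
    [/\ prime p, odd p, (n < 4 * p)%N, (2 * k * n < (2 * k + 1) * (2 * p))%N &
        z ^+ n * (2 * (\sum_(i < p) 'C(n, i))%N%:R) <= 2 ^+ n].
Proof.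
move=> k0 z0 a b hz.
have kR : 1 <= k%:R :> R by rewrite ler1n.
have K0 : 0 < 2 * k%:R + 1 :> R by lra.
have a0 : 0 < a by rewrite divr_gt0 //; lra.
have b0 : 0 < b by rewrite divr_gt0 //; lra.
have ab : a + b = 1 by rewrite /a /b; field; rewrite gt_eqF.
have aleb : a < b by rewrite ltr_pM2r ?invr_gt0 //; lra.
(* The optimal weight for p near a n: as 1 + t = 1/b, the base (1 + t) t^(-a) equals a^(-a)
   b^(-b). *)
pose t := a / b.
have t0 : 0 < t by rewrite divr_gt0.
have t1 : t < 1 by rewrite ltr_pdivrMr // mul1r.
have lt0 : ln t < 0 by rewrite ln_lt0 // t0.
have lt : ln t = ln a - ln b by rewrite ln_div.
have tb : (1 + t) * b = 1 by rewrite /t mulrDl mul1r divfK ?gt_eqF // addrC.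
have l1t : ln (1 + t) = - ln b.
  by have := congr1 (@ln R) tb; rewrite ln1 lnM ?posrE; [lra | lra | ].
pose g := ln 2 + a * ln a + b * ln b - ln z.
have g0 : 0 < g by rewrite /g; lra.
(* Taking p up to (1 + eps) a n instead of a n costs eps a (-ln t) = g/2 per dimension; the
   remaining g/2 pays for the factor 2. *)
pose eps := g / (2 * a * - ln t).
have den : 0 < 2 * a * - ln t by rewrite mulr_gt0 ?oppr_gt0 // mulr_gt0.
have e0 : 0 < eps by rewrite divr_gt0.
have e1 : 1 < 1 + eps by lra.
have [x0 Hx] := @prime_in_short_interval R (1 + eps) e1.
(* Beyond it a n >= x0 yields the prime, a n >= 2 makes it odd, and ln 2 <= n g/2. *)
pose bound := Num.max (Num.max x0 2 / a) (2 * ln 2 / g).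
exists (Num.truncn bound).+1 => n hn.
have nb : bound <= n%:R by apply: le_trans (ltW (truncnS_gt _)) _; rewrite ler_nat.
move: nb; rewrite /bound ge_max => /andP[nb1 nb2].
have [xa a2] : x0 <= a * n%:R /\ 2 <= a * n%:R.
  move: nb1; rewrite ler_pdivrMr // mulrC ge_max => /andP[? ?]; split=> //.
have [p pp /andP[p1 p2]] := Hx _ xa.
exists p.
have kn : (2 * k * n < (2 * k + 1) * (2 * p))%N.
  rewrite -(ltr_nat R) !natrM natrD natrM.
  by move: p1; rewrite /a mulrAC ltr_pdivrMr //; lra.
have n4 : (n < 4 * p)%N.
  clear -kn k0; rewrite -(ltn_pmul2l k0); apply: (@leq_trans ((2 * k + 1) * p)); first by lia.
  by rewrite mulnA leq_mul2r; apply/orP; right; lia.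
have oddp : odd p.
  have : (2 < p)%N by rewrite -(ltr_nat R); lra.
  by apply: contraTT => /(prime_oddPn pp) ->.
split=> //.
have tail := @binomial_tail t n p ltac:(by rewrite t0 ltW).
set S := (\sum_(i < p) 'C(n, i))%N in tail *.
have tp : 0 < t ^+ p by rewrite exprn_gt0.
rewrite -(ler_pM2l tp).
apply: le_trans (_ : 2 * z ^+ n * (1 + t) ^+ n <= _).
  have : 2 * z ^+ n * (t ^+ p * S%:R) <= 2 * z ^+ n * (1 + t) ^+ n.
    by rewrite ler_wpM2l // mulr_ge0 // exprn_ge0 // ltW.
  by apply: le_trans; rewrite le_eqVlt; apply/orP; left; apply/eqP; ring.
have tt : 0 < 1 + t by lra.
have zn : 0 < z ^+ n by rewrite exprn_gt0.
have tn : 0 < (1 + t) ^+ n by rewrite exprn_gt0.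
have n2 : 0 < 2 ^+ n :> R by rewrite exprn_gt0.
have z2 : 0 < 2 * z ^+ n by rewrite mulr_gt0.
rewrite -ler_ln ?posrE ?mulr_gt0 //.
have -> : ln (2 * z ^+ n * (1 + t) ^+ n) = ln 2 + n%:R * ln z - n%:R * ln b.
  rewrite (lnM z2 tn) (@lnM R 2 (z ^+ n)) ?posrE // (lnXn n z0) (lnXn n tt) l1t.
  by rewrite -[ln z *+ n]mulr_natl -[(- ln b) *+ n]mulr_natl mulrN.
have -> : ln (t ^+ p * 2 ^+ n) = p%:R * ln t + n%:R * ln 2.
  rewrite (lnM tp n2) (lnXn p t0) (@lnXn R n 2) //.
  by rewrite -[ln t *+ p]mulr_natl -[ln 2 *+ n]mulr_natl.
have h1 : p%:R * ln t >= (1 + eps) * (a * n%:R) * ln t by rewrite ler_wnM2r // ltW.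
have h2 : eps * a * - ln t = g / 2.
  by rewrite /eps; field; rewrite ?(gt_eqF a0) ?(lt_eqF lt0).
have h3 : ln 2 <= n%:R * g / 2.
  by move: nb2; rewrite ler_pdivrMr //; lra.
have h4 : g = ln 2 + a * ln t + ln b - ln z.
  by rewrite /g lt (_ : b = 1 - a); [ring | rewrite -ab; ring].
have h5 : n%:R * (eps * a * - ln t) = n%:R * (g / 2) by rewrite h2.
have h6 : n%:R * g = n%:R * (ln 2 + a * ln t + ln b - ln z) by rewrite -h4.
lra.
Qed.

End CubeGraph.

Theorem theorem9 (R : realType) (k : nat) (k_gt0 : (0 < k)%N) :
  ((2 * (k%:R / (2 * k%:R + 1)) `^ (k%:R / (2 * k%:R + 1))
      * ((k%:R + 1) / (2 * k%:R + 1)) `^ ((k%:R + 1) / (2 * k%:R + 1)))%:E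
   <= zeta_odd_girth R (2 * k + 1)%N)%E.
Proof.
set zeta := (X in (X%:E <= _)%E).
have kR : 1 <= k%:R :> R by rewrite ler1n.
have K0 : 0 < 2 * k%:R + 1 :> R by lra.
have a0 : 0 < k%:R / (2 * k%:R + 1) :> R by rewrite divr_gt0 //; lra.
have b0 : 0 < (k%:R + 1) / (2 * k%:R + 1) :> R by rewrite divr_gt0 //; lra.
have zeta0 : 0 < zeta by rewrite !mulr_gt0 ?powR_gt0.
apply/lee_addgt0Pr => e e0.
(* The maximum with [zeta / 2] keeps z positive, so that ln z is meaningful. *)
pose z := Num.max (zeta - e) (zeta / 2).
have z0 : 0 < z by rewrite lt_max; apply/orP; right; lra.
have zz : z < zeta by rewrite gt_max; apply/andP; split; lra.
have ze : zeta <= z + e.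
  have : zeta - e <= z by rewrite le_max lexx.
  lra.
apply: le_trans (_ : (z + e)%:E <= _)%E; first by rewrite lee_fin.
rewrite EFinD leeD2r //; apply: ereal_sup_ubound; exists z => //.
have lz : ln z < ln zeta by rewrite ltr_ln.
rewrite /zeta in lz; rewrite lnM ?posrE ?mulr_gt0 ?powR_gt0 // lnM ?posrE ?powR_gt0 // !ln_powR in lz.
have [n0 Hn0] := cube_parameters k_gt0 z0 lz.
(* For n < n0 the bound (z + delta n)^n is 0. *)
exists (fun n => if (n < n0)%N then - z else 0).
  apply: cvg_near_cst; exists n0 => // n /= n0n.
  by rewrite ltnNge n0n.
move=> n npos; case: ltnP => hn.
  (* With p = n the distance 2n exceeds n, so this graph has no edges. *)
  exists (cube_graph R n npos); split.
  - exact: cube_distance_graph.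
  - by apply: cube_odd_girth; clear -npos; nia.
  - by rewrite subrr expr0n gtn_eqF //; exact: chromatic_number_ge0.
have [p [pp oddp n4p kn hz]] := Hn0 n hn.
exists (cube_graph R n (prime_gt0 pp)); split.
- exact: cube_distance_graph.
- exact: cube_odd_girth.
- by rewrite addr0; exact: cube_chromatic.
Qed.
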